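(* For every positive integer $n$, $$(2n)!\,A_n=\sum_{M\in\mathcal{M}(2n)}\omega X_{\mathrm{Inc}(P_M)},$$ where $\mathcal{M}(2n)$ is the set of all perfect matchings on the vertex set $[2n]$.
   Context: $A_n=\frac{1}{(2n)!}\sum_{\lambda\vdash n}|\phi(\lambda)|\,p_\lambda$, where for $\lambda=\langle 1^{m_1},\dots,n^{m_n}\rangle\vdash n$ ($m_k$ parts equal to $k$), $\phi(\lambda)=(2n)!\prod_{k=1}^n\frac{1}{m_k!}\left(\frac{4^k(4^k-1)B_{2k}}{(2k)(2k)!}\right)^{m_k}$ with $B_{2k}$ Bernoulli numbers, and $p_\lambda$ power sums. For a perfect matching $M$ on $[2n]$, $P_M$ is the poset whose elements are the edges of $M$, with $\{a,b\}<\{c,d\}$ iff $\max\{a,b\}<\min\{c,d\}$. $\mathrm{Inc}(P)$ is the incomparability graph of a poset $P$ (vertices the elements of $P$, edges between incomparable pairs). For a graph $G$ on vertex set $V$, its chromatic symmetric function is $X_G=\sum_\kappa\prod_{v\in V}x_{\kappa(v)}$, summed over proper colorings $\kappa\colon V\to\{1,2,\dots\}$. $\omega$ is the involution on symmetric functions with $\omega(h_n)=e_n$. *)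

(* Defs.v *)
From HB Require Import structures.
From mathcomp Require Import all_boot all_order all_algebra.
From mathcomp Require Import perm mpoly.
From mathcomp Require boolp.

Set Implicit Arguments.
Unset Strict Implicit.
Unset Printing Implicit Defensive.

Import Order.TTheory GRing.Theory Num.Theory.
Local Open Scope ring_scope.

(* trunc : Q[x_0, ..., x_N] -> Q[x_0, ..., x_(N-1)] sets the last variable to 0. *)
Definition trunc_var N (i : 'I_N.+1) : {mpoly rat[N]} :=
  if unlift ord_max i is Some j then 'X_j else 0.

Definition trunc N (p : {mpoly rat[N.+1]}) : {mpoly rat[N]} :=
  p \mPo [tuple trunc_var i | i < N.+1].

HB.instance Definition _ N :=
  GRing.LRMorphism.copy (@trunc N) (comp_mpoly [tuple trunc_var i | i < N.+1]).

(* The ring Lambda_Q of symmetric functions in infinitely many variables, as the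
   inverse limit, in the category of graded rings, of the rings of symmetric
   polynomials in N variables: f N is the image of f under
   x_N = x_(N+1) = ... = 0. *)
Record symfun := Symfun {
  sf_at :> forall N, {mpoly rat[N]};
  sf_sym : forall N, sf_at N \is symmetric;
  sf_trunc : forall N, trunc (sf_at N.+1) = sf_at N;
  sf_bound : exists d, forall N, (msize (sf_at N) <= d)%N
}.

HB.instance Definition _ := boolp.gen_eqMixin symfun.
HB.instance Definition _ := boolp.gen_choiceMixin symfun.

Lemma symfunP (f g : symfun) : (forall N, f N = g N) -> f = g.
Proof.
case: f g => [f f1 f2 f3] [g g1 g2 g3] /= eq_fg.
have fg : f = g by apply: boolp.functional_extensionality_dep.
by subst g; congr Symfun; apply: boolp.Prop_irrelevance.
Qed.

Lemma sf_bound2 (f g : symfun) :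
  exists d, forall N, (msize (f N) <= d)%N && (msize (g N) <= d)%N.
Proof.
have [d hd] := sf_bound f; have [d' hd'] := sf_bound g.
exists (maxn d d') => N.
by rewrite (leq_trans (hd N)) ?leq_maxl // (leq_trans (hd' N)) ?leq_maxr.
Qed.

Program Definition sf_zero := @Symfun (fun N => 0) _ _ _.
Next Obligation. exact: rpred0. Qed.
Next Obligation. by rewrite raddf0. Qed.
Next Obligation. by exists 0%N => N; rewrite msize0. Qed.

Program Definition sf_one := @Symfun (fun N => 1) _ _ _.
Next Obligation. exact: rpred1. Qed.
Next Obligation. by rewrite rmorph1. Qed.
Next Obligation. by exists 1%N => N; rewrite msize1. Qed.

Program Definition sf_add (f g : symfun) := @Symfun (fun N => f N + g N) _ _ _.
Next Obligation. by apply: rpredD; apply: sf_sym. Qed.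
Next Obligation. by rewrite raddfD /= !sf_trunc. Qed.
Next Obligation.
have [d hd] := sf_bound2 f g; exists d => N; have /andP[h1 h2] := hd N.
by rewrite (leq_trans (msizeD_le _ _)) // geq_max h1 h2.
Qed.

Program Definition sf_opp (f : symfun) := @Symfun (fun N => - f N) _ _ _.
Next Obligation. by rewrite rpredN; apply: sf_sym. Qed.
Next Obligation. by rewrite raddfN /= !sf_trunc. Qed.
Next Obligation. by have [d hd] := sf_bound f; exists d => N; rewrite msizeN. Qed.

Program Definition sf_mul (f g : symfun) := @Symfun (fun N => f N * g N) _ _ _.
Next Obligation. by apply: rpredM; apply: sf_sym. Qed.
Next Obligation. by rewrite rmorphM /= !sf_trunc. Qed.
Next Obligation.
have [d hd] := sf_bound2 f g; exists (d + d).+1 => N; have /andP[h1 h2] := hd N.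
by rewrite (leq_trans (msizeM_le _ _)) // ltnS leq_add.
Qed.

Program Definition sf_scale (c : rat) (f : symfun) :=
  @Symfun (fun N => c *: f N) _ _ _.
Next Obligation. by apply: rpredZ; apply: sf_sym. Qed.
Next Obligation. by rewrite linearZ /= !sf_trunc. Qed.
Next Obligation.
have [d hd] := sf_bound f; exists d => N.
by rewrite (leq_trans (msizeZ_le _ _)).
Qed.

Lemma sf_addA : associative sf_add.
Proof. by move=> f g h; apply: symfunP => N /=; rewrite addrA. Qed.
Lemma sf_addC : commutative sf_add.
Proof. by move=> f g; apply: symfunP => N /=; rewrite addrC. Qed.
Lemma sf_add0 : left_id sf_zero sf_add.
Proof. by move=> f; apply: symfunP => N /=; rewrite add0r. Qed.
Lemma sf_addN : left_inverse sf_zero sf_opp sf_add.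
Proof. by move=> f; apply: symfunP => N /=; rewrite addNr. Qed.

HB.instance Definition _ :=
  GRing.isZmodule.Build symfun sf_addA sf_addC sf_add0 sf_addN.

Lemma sf_mulA : associative sf_mul.
Proof. by move=> f g h; apply: symfunP => N /=; rewrite mulrA. Qed.
Lemma sf_mulC : commutative sf_mul.
Proof. by move=> f g; apply: symfunP => N /=; rewrite mulrC. Qed.
Lemma sf_mul1 : left_id sf_one sf_mul.
Proof. by move=> f; apply: symfunP => N /=; rewrite mul1r. Qed.
Lemma sf_mulD : left_distributive sf_mul sf_add.
Proof. by move=> f g h; apply: symfunP => N /=; rewrite mulrDl. Qed.
Lemma sf_one_neq0 : sf_one != sf_zero.
Proof.
apply/eqP => /(congr1 (fun f : symfun => f 0%N)) /= /eqP.
by rewrite oner_eq0.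
Qed.

HB.instance Definition _ := GRing.Zmodule_isComNzRing.Build symfun
  sf_mulA sf_mulC sf_mul1 sf_mulD sf_one_neq0.

Lemma sf_scaleA a b f : sf_scale a (sf_scale b f) = sf_scale (a * b) f.
Proof. by apply: symfunP => N /=; rewrite scalerA. Qed.
Lemma sf_scale1 : left_id 1 sf_scale.
Proof. by move=> f; apply: symfunP => N /=; rewrite scale1r. Qed.
Lemma sf_scaleDr : right_distributive sf_scale +%R.
Proof. by move=> c f g; apply: symfunP => N /=; rewrite scalerDr. Qed.
Lemma sf_scaleDl f : {morph sf_scale^~ f : a b / a + b}.
Proof. by move=> a b; apply: symfunP => N /=; rewrite scalerDl. Qed.

HB.instance Definition _ := GRing.Zmodule_isLmodule.Build rat symfun
  sf_scaleA sf_scale1 sf_scaleDr sf_scaleDl.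

Lemma sf_scaleAl (a : rat) (f g : symfun) : a *: (f * g) = (a *: f) * g.
Proof. by apply: symfunP => N /=; rewrite scalerAl. Qed.

HB.instance Definition _ := GRing.Lmodule_isLalgebra.Build rat symfun sf_scaleAl.
HB.instance Definition _ := GRing.Lalgebra_isComAlgebra.Build rat symfun.

Lemma truncZ N c (p : {mpoly rat[N.+1]}) : trunc (c *: p) = c *: trunc p.
Proof. exact: comp_mpolyZ. Qed.

Lemma trunc_var_max N : trunc_var (@ord_max N) = 0.
Proof. by rewrite /trunc_var unlift_none. Qed.

Lemma trunc_var_widen N (i : 'I_N) : trunc_var (widen_ord (leqnSn N) i) = 'X_i.
Proof.
have -> : widen_ord (leqnSn N) i = lift ord_max i.
  by apply: val_inj; rewrite /= /bump leqNgt ltn_ord.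
by rewrite /trunc_var liftK.
Qed.

Lemma truncX N (m : 'X_{1..N.+1}) :
  trunc 'X_[m] = if m ord_max == 0%N
    then 'X_[[multinom m (widen_ord (leqnSn N) i) | i < N]] else 0.
Proof.
rewrite /trunc comp_mpolyX big_ord_recr /= tnth_mktuple trunc_var_max.
have [->|] := eqVneq (m ord_max) 0%N; last first.
  by move=> m0; rewrite expr0n (negbTE m0) mulr0.
rewrite expr0 mulr1 mpolyXE_id; apply: eq_bigr => i _.
by rewrite tnth_mktuple trunc_var_widen mnmE.
Qed.

Lemma truncU N (i : 'I_N.+1) : trunc 'X_i = trunc_var i.
Proof. by rewrite /trunc comp_mpolyXU -tnth_nth tnth_mktuple. Qed.

Lemma mcoeff_trunc N (p : {mpoly rat[N.+1]}) (m : 'X_{1..N}) :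
  (trunc p)@_m = p@_(mnmwiden m).
Proof.
rewrite [p in LHS]mpolyE (raddf_sum (@trunc N)) /= raddf_sum /=.
rewrite [p in RHS]mpolyE raddf_sum /=; apply: eq_bigr => m' _.
rewrite truncZ !mcoeffZ truncX mcoeffX; congr (_ * _).
have [m'0|m'0] := eqVneq (m' ord_max) 0%N; last first.
  rewrite mcoeff0; have [m'E|//] := eqVneq m' (mnmwiden m).
  by rewrite m'E mnmwiden_ordmax in m'0.
rewrite mcoeffX; congr (_%:R); congr (nat_of_bool _); apply/eqP/eqP => [<-|->].
  apply/mnmP => i; have [j ->|->] := unliftP ord_max i; last first.
    by rewrite mnmwiden_ordmax.
  have -> : lift ord_max j = widen_ord (leqnSn N) j.
    by apply: val_inj; rewrite /= /bump leqNgt ltn_ord.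
  by rewrite mnmwiden_widen mnmE.
by apply/mnmP => i; rewrite mnmE mnmwiden_widen.
Qed.

Lemma mdeg_mnmwiden N (m : 'X_{1..N}) : mdeg (mnmwiden m) = mdeg m.
Proof.
rewrite !mdegE big_ord_recr /= mnmwiden_ordmax addn0.
by apply: eq_bigr => i _; rewrite mnmwiden_widen.
Qed.

Program Definition sf_e (k : nat) := @Symfun (fun N => mesym N rat k) _ _ _.
Next Obligation. exact: mesym_sym. Qed.
Next Obligation.
apply/mpolyP => m; rewrite mcoeff_trunc !mcoeff_mesym /mechar mdeg_mnmwiden.
congr (_ && _)%:R; apply/forallP/forallP => h i.
  by have := h (widen_ord (leqnSn N) i); rewrite mnmwiden_widen.
have [j ->|->] := unliftP ord_max i; last by rewrite mnmwiden_ordmax.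
have -> : lift ord_max j = widen_ord (leqnSn N) j.
  by apply: val_inj; rewrite /= /bump leqNgt ltn_ord.
by rewrite mnmwiden_widen.
Qed.
Next Obligation.
exists k.+1 => N; rewrite msizeE; apply/bigmax_leqP_seq => m.
by rewrite mem_msupp_mesym => /andP[/eqP -> _].
Qed.

Definition hsym N k : {mpoly rat[N]} :=
  \sum_(m : 'X_{1..N < k.+1} | mdeg m == k) 'X_[m].

Lemma mcoeff_hsym N k m : (hsym N k)@_m = (mdeg m == k)%:R.
Proof.
rewrite /hsym raddf_sum /=; have [mk|mk] := eqVneq (mdeg m) k; last first.
  rewrite big1 // => m' /eqP m'k; rewrite mcoeffX.
  by have [mm'|//] := eqVneq (val m') m; rewrite -mm' m'k eqxx in mk.
have hm : (mdeg m < k.+1)%N by rewrite mk.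
rewrite (bigD1 (BMultinom hm)) /= ?mk // mcoeffX eqxx big1 ?addr0 // => m'.
by case/andP=> _; rewrite mcoeffX -val_eqE /= => /negbTE ->.
Qed.

Program Definition sf_h (k : nat) := @Symfun (hsym^~ k) _ _ _.
Next Obligation.
apply/issymP => s; apply/mpolyP => m.
by rewrite mcoeff_sym !mcoeff_hsym mdeg_mperm.
Qed.
Next Obligation.
by apply/mpolyP => m; rewrite mcoeff_trunc !mcoeff_hsym mdeg_mnmwiden.
Qed.
Next Obligation.
exists k.+1 => N; rewrite msizeE; apply/bigmax_leqP_seq => m.
by rewrite mcoeff_msupp mcoeff_hsym; have [->|] := eqVneq (mdeg m) k.
Qed.

Lemma msymU N (s : 'S_N) (i : 'I_N) : msym s ('X_i : {mpoly rat[N]}) = 'X_(s i).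
Proof. by rewrite /msym mmapX mmap1U. Qed.

(* sf_p k is the power sum p_(k+1); the exponent is shifted because p_0 is not a
   symmetric function. *)
Program Definition sf_p (k : nat) :=
  @Symfun (fun N => \sum_(i < N) 'X_i ^+ k.+1) _ _ _.
Next Obligation.
apply/issymP => s; rewrite raddf_sum [RHS](reindex_inj (@perm_inj _ s)) /=.
by apply: eq_bigr => i _; rewrite rmorphXn /= msymU.
Qed.
Next Obligation.
rewrite (raddf_sum (@trunc N)) big_ord_recr /= rmorphXn /= truncU trunc_var_max expr0n addr0.
by apply: eq_bigr => i _; rewrite rmorphXn /= truncU trunc_var_widen.
Qed.
Next Obligation.
exists k.+2 => N; apply: (leq_trans (msize_sum _ _ _)).
apply/bigmax_leqP => i _; rewrite mpolyXn msizeX ltnS.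
by rewrite mdegMn mdeg1 mul1n.
Qed.

(* In N variables, X_G is the sum over the proper colorings with colors < N. *)
Definition proper_coloring (V : finType) (adj : rel V) N
    (kappa : {ffun V -> 'I_N}) : bool :=
  [forall u, forall v, adj u v ==> (kappa u != kappa v)].

Definition chromatic (V : finType) (adj : rel V) N : {mpoly rat[N]} :=
  \sum_(kappa : {ffun V -> 'I_N} | proper_coloring adj kappa)
     \prod_v 'X_(kappa v).

Program Definition sf_X (V : finType) (adj : rel V) :=
  @Symfun (chromatic adj) _ _ _.
Next Obligation.
apply/issymP => s; rewrite raddf_sum.
pose F (k : {ffun V -> 'I_N}) := [ffun v => s (k v)].
have Finj : injective F.
  move=> k k' /ffunP kk'; apply/ffunP => v; apply: (@perm_inj _ s).
  by have := kk' v; rewrite !ffunE.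
rewrite [RHS](reindex_inj Finj) /=; apply: eq_big => [k|k _].
  apply/eq_forallb => u; apply/eq_forallb => v.
  by rewrite !ffunE (inj_eq perm_inj).
by rewrite rmorph_prod /=; apply: eq_bigr => v _; rewrite msymU ffunE.
Qed.
Next Obligation.
rewrite raddf_sum /=.
pose inj := widen_ord (leqnSn N).
have injI : injective inj by move=> i j /(congr1 val) /= ij; apply: val_inj.
pose F (k : {ffun V -> 'I_N}) := [ffun v => inj (k v)].
have Finj : injective F.
  move=> k k' /ffunP kk'; apply/ffunP => v; apply: injI.
  by have := kk' v; rewrite !ffunE.
rewrite (bigID (mem [set F k | k : {ffun V -> 'I_N}])) /= addrC big1 ?add0r; last first.
  move=> k /andP[_ kF].
  have [v /eqP kv|nomax] := pickP (fun v => k v == ord_max).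
    by rewrite rmorph_prod (bigD1 v) //= kv truncU trunc_var_max mul0r.
  case/negP: kF; apply/imsetP.
  have lt v : (k v < N)%N.
    have := nomax v; rewrite -val_eqE /= ltn_neqAle => ->.
    by rewrite -ltnS ltn_ord.
  exists [ffun v => Ordinal (lt v)] => //; apply/ffunP => v.
  by rewrite !ffunE; apply: val_inj.
rewrite (eq_bigl (mem [set F k | k : {ffun V -> 'I_N} & proper_coloring adj k])); last first.
  move=> k /=; apply/andP/imsetP => [[pk /imsetP[k' _ kk']]|[k' + ->]].
    exists k' => //; rewrite inE; move: pk; rewrite kk'.
    move/forallP => h; apply/forallP => u; apply/forallP => v.
    by have /forallP/(_ v) := h u; rewrite !ffunE (inj_eq injI).
  rewrite inE => /forallP h; split; last by apply: imset_f.
  apply/forallP => u; apply/forallP => v.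
  by have /forallP/(_ v) := h u; rewrite !ffunE (inj_eq injI).
rewrite big_imset /=; last by move=> ? ? _ _; apply: Finj.
rewrite /chromatic; apply: eq_big => [k|k _]; first by rewrite inE.
rewrite rmorph_prod /=; apply: eq_bigr => v _.
by rewrite ffunE /= truncU trunc_var_widen.
Qed.
Next Obligation.
exists #|V|.+1 => N; apply: (leq_trans (msize_sum _ _ _)).
apply/bigmax_leqP => k _; rewrite mprodXE msizeX ltnS mdeg_sum.
by rewrite (eq_bigr (fun=> 1%N)) ?sum1_card // => v _; rewrite mdeg1.
Qed.

Definition sf_proj N (f : symfun) : {mpoly rat[N]} := f N.

Lemma sf_proj_is_linear N : linear (@sf_proj N).
Proof. by []. Qed.
HB.instance Definition _ N := GRing.isLinear.Build rat symfun {mpoly rat[N]} _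
  (@sf_proj N) (@sf_proj_is_linear N).

Lemma sf_proj_is_monoid_morphism N : monoid_morphism (@sf_proj N).
Proof. by []. Qed.
HB.instance Definition _ N := GRing.isMonoidMorphism.Build symfun {mpoly rat[N]}
  (@sf_proj N) (@sf_proj_is_monoid_morphism N).

Lemma symfun_eq0 d (f : symfun) :
  (forall N, (msize (f N) <= d.+1)%N) -> f d = 0 -> f = 0.
Proof.
move=> fd f0; apply: symfunP => N /=; rewrite -[RHS]/(0 : {mpoly rat[N]}).
have [Nd|dN] := leqP N d.
  elim: d Nd {fd} f0 => [|d IHd] Nd f0.
    by move: f0; rewrite -(_ : N = 0%N) //; apply/eqP; rewrite -leqn0.
  move: Nd; rewrite leq_eqVlt => /predU1P[-> //|].
  by rewrite ltnS => /IHd; apply; rewrite -sf_trunc f0 raddf0.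
rewrite -(subnK (ltnW dN)); elim: (N - d)%N => [|k IHk] //=.
rewrite addSn; set M := (k + d)%N in IHk *.
apply/mpolyP => m; rewrite mcoeff0.
have [dm|dm] := leqP (mdeg m) d; last first.
  apply: memN_msupp_eq0; apply: msize_mdeg_ge.
  exact: leq_trans (fd _) dm.
have [i mi] : exists i, m i = 0%N.
  have [i /eqP mi|mn0] := pickP (fun i => m i == 0%N); first by exists i.
  have : (M.+1 <= mdeg m)%N.
    rewrite mdegE -[leqLHS]card_ord -sum1_card; apply: leq_sum => i _.
    by rewrite lt0n mn0.
  by move=> /leq_trans /(_ dm); rewrite ltnNge leq_addl.
pose s := tperm i ord_max.
rewrite -(msym_coeff m s (sf_sym f M.+1)).
set m' := [multinom _ | _ < _].
have -> : m' = mnmwiden [multinom m' (widen_ord (leqnSn M) j) | j < M].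
  apply/mnmP => j; have [l ->|->] := unliftP ord_max j; last first.
    by rewrite mnmwiden_ordmax mnmE tpermR mi.
  have -> : lift ord_max l = widen_ord (leqnSn M) l.
    by apply: val_inj; rewrite /= /bump leqNgt ltn_ord.
  by rewrite mnmwiden_widen [RHS]mnmE.
by rewrite -mcoeff_trunc sf_trunc IHk mcoeff0.
Qed.

Lemma hsym0 N : hsym N 0 = 1.
Proof. by apply/mpolyP => m; rewrite mcoeff_hsym mcoeff1 mdeg_eq0. Qed.

Lemma hsymSS N k :
  hsym N.+1 k.+1 = mwiden (hsym N k.+1) + hsym N.+1 k * 'X_ord_max.
Proof.
apply/mpolyP => m; rewrite mcoeffD mcoeff_hsym.
have [m0|m0] := eqVneq (m ord_max) 0%N.
  have mE : m = mnmwiden [multinom m (widen_ord (leqnSn N) j) | j < N].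
    apply/mnmP => j; have [l ->|->] := unliftP ord_max j; last first.
      by rewrite mnmwiden_ordmax.
    have -> : lift ord_max l = widen_ord (leqnSn N) l.
      by apply: val_inj; rewrite /= /bump leqNgt ltn_ord.
    by rewrite mnmwiden_widen mnmE.
  rewrite {2}mE mwiden_mnmwiden mcoeff_hsym {1}mE mdeg_mnmwiden.
  rewrite [X in _ + X](_ : _ = 0) ?addr0 //.
  apply: memN_msupp_eq0; apply/negP => /msuppM_le /allpairsP[[u v] /= [_]].
  rewrite msuppX inE => /eqP -> mE'.
  by move: m0; rewrite mE' mnmDE mnm1E eqxx addn1.
rewrite [X in X + _](_ : _ = 0) ?add0r; last first.
  rewrite (mwidenE (k := msize (hsym N k.+1))) // raddf_sum /= big1 // => m' _.
  rewrite mcoeffZ mcoeffX; have [m'm|] := eqVneq; rewrite ?mulr0 //.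
  by rewrite -m'm mnmwiden_ordmax in m0.
have -> : m = (U_(ord_max) + (m - U_(ord_max)))%MM.
  by rewrite addmC submK // lep1mP.
rewrite mcoeffMX mcoeff_hsym mdegD mdeg1 add1n eqSS //.
Qed.

Lemma eh_rel k : \sum_(i < k.+2) (-1) ^+ i *: (sf_e i * sf_h (k.+1 - i)) = 0.
Proof.
apply: symfunP => N; rewrite -[LHS]/(sf_proj N _) raddf_sum /=.
rewrite -[RHS]/(0 : {mpoly rat[N]}).
elim: N => [|N IHN].
  rewrite big_ord_recl big1 ?addr0 => [|i _] /=; last first.
    rewrite /sf_proj /= mesym_geqnE ?mul0r ?scaler0 //.
  rewrite /sf_proj /= mesym0E mul1r scale1r; apply/mpolyP => m.
  by rewrite mcoeff_hsym mcoeff0 mdegE big_ord0.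
have e0 M : mesym M rat 0 = 1 by exact: mesym0E.
move: IHN; rewrite /sf_proj /= => IHN.
pose w := @mwiden N rat; pose x : {mpoly rat[N.+1]} := 'X_ord_max.
have step1 : \sum_(i < k.+2) (-1) ^+ i *: (mesym N.+1 rat i * hsym N.+1 (k.+1 - i))
  = \sum_(i < k.+2) (-1) ^+ i *: (w (mesym N rat i) * hsym N.+1 (k.+1 - i))
  - \sum_(i < k.+1) (-1) ^+ i *: (w (mesym N rat i) * x * hsym N.+1 (k - i)).
  rewrite big_ord_recl [in RHS]big_ord_recl /= -addrA; congr (_ + _).
    by rewrite !e0 /w mwiden1.
  rewrite -sumrB; apply: eq_bigr => i _ /=.
  rewrite /bump /= add1n subSS mesymSS mulrDl scalerDr; congr (_ + _).
  by rewrite exprS mulN1r scaleNr.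
rewrite step1 big_ord_recr /= subnn hsym0 mulr1.
transitivity (w (\sum_(i < k.+2) (-1) ^+ i *: (mesym N rat i * hsym N (k.+1 - i)))).
  rewrite [in RHS]big_ord_recr /= subnn hsym0 mulr1 /w mwidenD mwidenZ addrAC; congr (_ + _).
  rewrite -sumrB raddf_sum; apply: eq_bigr => i _ /=.
  rewrite mwidenZ mwidenM -scalerBr; congr (_ *: _).
  have ik : (i <= k)%N by rewrite -ltnS ltn_ord.
  rewrite (subSn ik) hsymSS -mulrA -mulrBr; congr (_ * _).
  by rewrite [x * _]mulrC addrK.
by rewrite IHN; apply: mwiden0.
Qed.

Definition sf_eval d (g : nat -> symfun) (P : {mpoly rat[d]}) : symfun :=
  mmap (in_alg symfun) (fun i : 'I_d => g i) P.

HB.instance Definition _ d g :=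
  GRing.RMorphism.copy (@sf_eval d g) (mmap (in_alg symfun) (fun i : 'I_d => g i)).

Lemma sf_evalZ d g c (P : {mpoly rat[d]}) : sf_eval g (c *: P) = c *: sf_eval g P.
Proof. by rewrite /sf_eval mmapZ /= -[in RHS](mul1r (mmap _ _ _)) scalerAl. Qed.

Lemma sf_evalX d g (i : 'I_d) : sf_eval g 'X_i = g i.
Proof. by rewrite /sf_eval mmapX mmap1U. Qed.

Lemma sf_eval_at d g (P : {mpoly rat[d]}) N :
  sf_eval g P N = P \mPo [tuple g i N | i < d].
Proof.
rewrite -[LHS]/(sf_proj N _) /sf_eval /comp_mpoly /mmap raddf_sum /=.
apply: eq_bigr => m _; congr (_ * _); first by rewrite -alg_mpolyC.
rewrite /mmap1 -[LHS]/(sf_proj N _) rmorph_prod /=.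
by apply: eq_bigr => i _; rewrite rmorphXn /= tnth_mktuple.
Qed.

Lemma sf_eval_widen d g (P : {mpoly rat[d]}) :
  sf_eval g (mwiden P) = sf_eval g P.
Proof.
rewrite [P]mpolyE (raddf_sum (@mwiden d rat)).
rewrite (raddf_sum (@sf_eval d.+1 g)) (raddf_sum (@sf_eval d g)) /=.
apply: eq_bigr => m _; rewrite mwidenZ !sf_evalZ mwidenX; congr (_ *: _).
rewrite /sf_eval !mmapX /mmap1 big_ord_recr /= mnmwiden_ordmax mulr1.
by apply: eq_bigr => i _; rewrite mnmwiden_widen.
Qed.

Lemma sf_eval_lift d d' (P : {mpoly rat[d]}) : (d <= d')%N ->
  exists Q : {mpoly rat[d']}, forall g, sf_eval g Q = sf_eval g P.
Proof.
move=> /subnK <-; elim: (d' - d)%N => [|k [Q QP]]; first by exists P.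
by exists (mwiden Q) => g; rewrite sf_eval_widen.
Qed.

Lemma sf_e0 : sf_e 0 = 1.
Proof. by apply: symfunP => N /=; rewrite mesym0E. Qed.

Lemma sf_h0 : sf_h 0 = 1.
Proof. by apply: symfunP => N /=; rewrite hsym0. Qed.

Lemma he_rel k : \sum_(i < k.+2) (-1) ^+ i *: (sf_h i * sf_e (k.+1 - i)) = 0.
Proof.
have := congr1 (fun f => (-1 : rat) ^+ k.+1 *: f) (eh_rel k).
rewrite /= scaler0 scaler_sumr => sum0; rewrite -[RHS]sum0.
rewrite (reindex_inj rev_ord_inj) /=; apply: eq_bigr => i _.
have ik : (i <= k.+1)%N by rewrite -ltnS ltn_ord.
rewrite subSS subKn // mulrC scalerA; congr (_ *: _).
by rewrite -signr_odd -(signr_odd _ k.+1) -(signr_odd _ i) -signr_addb oddB.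
Qed.

Lemma gen_swap (a b : nat -> symfun) (w : {lrmorphism symfun -> symfun}) :
    a 0%N = 1 -> b 0%N = 1 ->
    (forall k, \sum_(i < k.+2) (-1) ^+ i *: (a i * b (k.+1 - i)%N) = 0) ->
    (forall k, \sum_(i < k.+2) (-1) ^+ i *: (b i * a (k.+1 - i)%N) = 0) ->
  (forall k, w (a k) = b k) -> forall k, w (b k) = a k.
Proof.
move=> a0 b0 ab ba wa; elim/ltn_ind => -[_|k IHk].
  by rewrite a0 b0 rmorph1.
have solve (c d : nat -> symfun) : c 0%N = 1 ->
    \sum_(i < k.+2) (-1) ^+ i *: (c i * d (k.+1 - i)%N) = 0 ->
    d k.+1 = - \sum_(i < k.+1) (-1) ^+ i.+1 *: (c i.+1 * d (k - i)%N).
  move=> c0; rewrite big_ord_recl /= subn0 c0 mul1r scale1r => /eqP.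
  by rewrite addr_eq0 => /eqP.
rewrite (solve a b) // (solve b a) // (raddfN w) (raddf_sum w); congr (- _).
apply: eq_bigr => i _; rewrite /= linearZ /= rmorphM /= wa IHk //.
by rewrite ltnS leq_subr.
Qed.

Lemma msize_eval_e d N (P : {mpoly rat[d]}) :
  (msize (sf_eval (fun i => sf_e i.+1) P N) <= mweight P)%N.
Proof.
rewrite sf_eval_at comp_mpolyEX; apply: leq_trans (msize_sum _ _ _) _.
apply/bigmax_leqP_seq => m mP _; apply: leq_trans (msizeZ_le _ _) _.
rewrite comp_mpolyX.
suff hom : \prod_(i < d) tnth [tuple sf_e i.+1 N | i < d] i ^+ m i
    \is (mnmwgt m).-homog.
  rewrite msizeE; apply/bigmax_leqP_seq => m' m'P _.
  by rewrite (dhomog_mf hom m'P) mmeasure_mnm_lt.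
rewrite /mnmwgt; elim/big_rec2: _ => [|i n q _ hq]; first exact: dhomog1.
rewrite mulnC; apply: dhomogM hq; apply: dhomogMn; rewrite tnth_mktuple /=.
apply/dhomogP => m' /=; rewrite mem_msupp_mesym.
by case/andP => /eqP.
Qed.

Lemma e_gen (f : symfun) :
  exists d (P : {mpoly rat[d]}), f = sf_eval (fun i => sf_e i.+1) P.
Proof.
have [d fd] := sf_bound f; exists d.
have [P [PE Pw]] := sym_fundamental (sf_sym f d).
exists P; apply/eqP; rewrite -subr_eq0; apply/eqP.
apply: (@symfun_eq0 d) => [N|].
  apply: leq_trans (msizeD_le _ _) _; rewrite geq_max msizeN.
  rewrite (leq_trans (fd N)) //= (leq_trans (msize_eval_e _ _)) //.
  by rewrite (leq_trans Pw) // (leq_trans (fd d)).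
by rewrite -[LHS]/(f d - sf_eval _ P d) sf_eval_at -PE subrr.
Qed.

Lemma e_indep d (P : {mpoly rat[d]}) :
  sf_eval (fun i => sf_e i.+1) P = 0 -> P = 0.
Proof.
move=> P0; apply: msym_fundamental_un0.
by rewrite -[RHS]/(sf_zero d) -[sf_zero]P0 sf_eval_at.
Qed.

Definition omega_fun (f : symfun) : symfun :=
  sf_eval (fun i => sf_h i.+1) (sval (boolp.cid (svalP (boolp.cid (e_gen f))))).

Lemma omega_funE d (P : {mpoly rat[d]}) :
  omega_fun (sf_eval (fun i => sf_e i.+1) P) = sf_eval (fun i => sf_h i.+1) P.
Proof.
rewrite /omega_fun; case: (boolp.cid (e_gen _)) => d' ex /=.
case: (boolp.cid _) => P' /= PE.
have [Q QE] := sf_eval_lift P (leq_maxl d d').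
have [Q' QE'] := sf_eval_lift P' (leq_maxr d d').
rewrite -QE -QE'; congr (sf_eval _ _); apply/esym/eqP; rewrite -subr_eq0.
by apply/eqP/e_indep; rewrite raddfB /= QE QE' PE subrr.
Qed.

Lemma e_gen2 (f g : symfun) : exists d (P Q : {mpoly rat[d]}),
  f = sf_eval (fun i => sf_e i.+1) P /\ g = sf_eval (fun i => sf_e i.+1) Q.
Proof.
have [d [P ->]] := e_gen f; have [d' [P' ->]] := e_gen g.
exists (maxn d d').
have [Q QE] := sf_eval_lift P (leq_maxl d d').
have [Q' QE'] := sf_eval_lift P' (leq_maxr d d').
by exists Q, Q'; rewrite QE QE'.
Qed.

Lemma omega_fun_is_linear : linear omega_fun.
Proof.
move=> c f g; have [d [P [Q [-> ->]]]] := e_gen2 f g.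
by rewrite -sf_evalZ -raddfD !omega_funE raddfD /= sf_evalZ.
Qed.
HB.instance Definition _ := GRing.isLinear.Build rat symfun symfun _
  omega_fun omega_fun_is_linear.

Lemma omega_fun_is_monoid_morphism : monoid_morphism omega_fun.
Proof.
split=> [|f g].
  by rewrite -[X in omega_fun X](rmorph1 (@sf_eval 0 (fun i => sf_e i.+1)))
             omega_funE rmorph1.
have [d [P [Q [-> ->]]]] := e_gen2 f g.
by rewrite -rmorphM !omega_funE rmorphM.
Qed.
HB.instance Definition _ := GRing.isMonoidMorphism.Build symfun symfun
  omega_fun omega_fun_is_monoid_morphism.

Lemma omega_exists :
  exists w : {lrmorphism symfun -> symfun}, forall k, w (sf_h k) = sf_e k.
Proof.
exists omega_fun; apply: gen_swap sf_e0 sf_h0 eh_rel he_rel _ => -[|k].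
  by rewrite sf_e0 sf_h0 rmorph1.
have := omega_funE ('X_ord_max : {mpoly rat[k.+1]}).
by rewrite !sf_evalX.
Qed.

(* The unique (omega_unique) algebra endomorphism with omega h_k = e_k. *)
Definition omega : {lrmorphism symfun -> symfun} := sval (boolp.cid omega_exists).

Lemma omega_h k : omega (sf_h k) = sf_e k.
Proof. exact: (svalP (boolp.cid omega_exists)). Qed.

Lemma omega_e k : omega (sf_e k) = sf_h k.
Proof. exact: gen_swap sf_h0 sf_e0 he_rel eh_rel omega_h k. Qed.

Lemma lrmorph_eval (w : {lrmorphism symfun -> symfun}) d g (P : {mpoly rat[d]}) :
  w (sf_eval g P) = sf_eval (fun i => w (g i)) P.
Proof.
rewrite [P]mpolyE !(raddf_sum (@sf_eval d _)) (raddf_sum w) /=.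
apply: eq_bigr => m _; rewrite !sf_evalZ linearZ /=; congr (_ *: _).
rewrite /sf_eval !mmapX /mmap1 rmorph_prod /=.
by apply: eq_bigr => i _; rewrite rmorphXn.
Qed.

Lemma omega_unique (w : {lrmorphism symfun -> symfun}) :
  (forall k, w (sf_h k) = sf_e k) -> w =1 omega.
Proof.
move=> wh; have we k : w (sf_e k) = sf_h k.
  exact: gen_swap sf_h0 sf_e0 he_rel eh_rel wh k.
move=> f; have [d [P ->]] := e_gen f; rewrite !lrmorph_eval.
by congr sf_eval; apply: boolp.functional_extensionality_dep => i;
  rewrite we omega_e.
Qed.

Lemma omegaK : involutive omega.
Proof.
move=> f; have [d [P ->]] := e_gen f; rewrite !lrmorph_eval.
by congr sf_eval; apply: boolp.functional_extensionality_dep => i;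
  rewrite omega_e omega_h.
Qed.

Fixpoint bernoulli_seq (n : nat) : seq rat :=
  if n is m.+1 then
    let s := bernoulli_seq m in
    rcons s (((m == 0%N)%:R - \sum_(k < m) 'C(m.+1, k)%:R * s`_k) / m.+1%:R)
  else [::].

Definition bernoulli (n : nat) : rat := (bernoulli_seq n.+1)`_n.

Lemma size_bernoulli_seq n : size (bernoulli_seq n) = n.
Proof. by elim: n => //= n IHn; rewrite size_rcons IHn. Qed.

Lemma nth_bernoulli_seq n k : (k < n)%N -> (bernoulli_seq n)`_k = bernoulli k.
Proof.
elim: n => // n IHn; rewrite ltnS leq_eqVlt => /predU1P[-> //|kn].
by rewrite /= nth_rcons size_bernoulli_seq kn IHn.
Qed.

Lemma bernoulli_rec n :
  \sum_(k < n.+1) 'C(n.+1, k)%:R * bernoulli k = (n == 0%N)%:R.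
Proof.
rewrite big_ord_recr /= {2}/bernoulli /= nth_rcons size_bernoulli_seq ltnn eqxx.
rewrite binSn mulrCA divff ?pnatr_eq0 // mulr1.
rewrite addrC [X in _ - X + _](eq_bigr (fun k : 'I_n =>
  'C(n.+1, k)%:R * bernoulli k)) ?subrK // => k _.
by rewrite nth_bernoulli_seq.
Qed.

(* A partition <1^m_1, ..., n^m_n> of n, given by its multiplicities: the index
   k : 'I_n stands for parts equal to k+1, here and in the products below. *)
Definition intpart n :=
  {m : {ffun 'I_n -> 'I_n.+1} | (\sum_(k < n) k.+1 * m k)%N == n}.

Definition mult n (la : intpart n) (k : 'I_n) : nat := val la k.

Definition phi n (la : intpart n) : rat :=
  (2 * n)`!%:R * \prod_(k < n)
    ((mult la k)`!%:R^-1 *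
     (4 ^+ k.+1 * (4 ^+ k.+1 - 1) * bernoulli (2 * k.+1)
       / ((2 * k.+1)%:R * (2 * k.+1)`!%:R)) ^+ mult la k).

Definition sf_p_part n (la : intpart n) : symfun :=
  \prod_(k < n) sf_p k ^+ mult la k.

Definition Asym n : symfun :=
  (2 * n)`!%:R^-1 *: \sum_(la : intpart n) `|phi la| *: sf_p_part la.

Definition is_perfect_matching (V : finType) (M : {set {set V}}) : bool :=
  partition M [set: V] && [forall e in M, #|e| == 2].

(* Perfect matchings on [2n], the vertices being numbered from 0. *)
Definition perfect_matching n :=
  {M : {set {set 'I_(2 * n)}} | is_perfect_matching M}.

Definition matching_poset n (M : perfect_matching n) : Type :=
  {e : {set 'I_(2 * n)} | e \in val M}.

HB.instance Definition _ n (M : perfect_matching n) :=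
  Finite.on (@matching_poset n M).

(* The default value 2n in edge_min is irrelevant, edges being nonempty. *)
Definition edge_max n (e : {set 'I_(2 * n)}) : nat := \max_(a in e) a.
Definition edge_min n (e : {set 'I_(2 * n)}) : nat :=
  \big[minn/(2 * n)%N]_(a in e) a.

Definition edge_lt n (M : perfect_matching n) (e f : matching_poset M) : bool :=
  (edge_max (val e) < edge_min (val f))%N.

Lemma edge_min_le n (e : {set 'I_(2 * n)}) a : a \in e -> (edge_min e <= a)%N.
Proof.
move=> ae; rewrite /edge_min; have := mem_index_enum a.
elim: index_enum => // b r IHr; rewrite inE big_cons => /predU1P[<-|/IHr le_a].
  by rewrite ae geq_minl.
by case: ifP => // _; rewrite geq_min le_a orbT.
Qed.

Lemma edge_min_max n (M : perfect_matching n) (e : matching_poset M) :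
  (edge_min (val e) <= edge_max (val e))%N.
Proof.
have /andP[_ /forall_inP/(_ _ (valP e)) /eqP e2] := valP M.
have [a ae] : exists a, a \in val e by apply/card_gt0P; rewrite e2.
apply: (@leq_trans a); last exact: (@leq_bigmax_cond _ _ (fun a => val a) _ ae).
exact: edge_min_le.
Qed.

Lemma edge_lt_irr n (M : perfect_matching n) : irreflexive (@edge_lt n M).
Proof. by move=> e; rewrite /edge_lt ltnNge edge_min_max. Qed.

Lemma edge_lt_trans n (M : perfect_matching n) : transitive (@edge_lt n M).
Proof.
move=> f e g ef fg; apply: ltn_trans fg; apply: leq_trans ef _.
exact: edge_min_max.
Qed.

Definition edge_display : Order.disp_t := Order.Disp tt tt.

HB.instance Definition _ n (M : perfect_matching n) :=
  Order.Lt_isPOrder.Build edge_display (@matching_poset n M)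
    (@edge_lt_irr n M) (@edge_lt_trans n M).

Definition Inc (disp : Order.disp_t) (P : finPOrderType disp) : rel P :=
  fun x y => (x >< y)%O.
Arguments Inc {disp} P.

Lemma edge_ltE n (M : perfect_matching n) (e f : matching_poset M) :
  (e < f)%O = (edge_max (val e) < edge_min (val f))%N.
Proof. by []. Qed.

Lemma IncE (disp : Order.disp_t) (P : finPOrderType disp) (x y : P) :
  Inc P x y = [&& x != y, ~~ (x < y)%O & ~~ (y < x)%O].
Proof. by rewrite /Inc; case: comparableP. Qed.

(* Main.v *)
(** In finitely many variables, a pair of a matching and a proper colouring of
    [Inc(P_M)] is the same thing as a colouring of the points of [2n] with even
    colour classes: a class that is a chain must be matched first with second,
    third with fourth, and so on. Hence [\sum_M X_Inc(P_M) / (2n)!] is the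
    degree [n] part of [\prod_i cosh (sqrt x_i)], that is, of
    [exp (\sum_k c_k p_k)] with [log (cosh x) = \sum_k c_k x^(2k)] and
    [c_k = 4^k (4^k - 1) B_(2k) / (2k (2k)!)]. Since [omega p_k = (-1)^(k-1) p_k]
    and [(-1)^(k-1) c_k >= 0], applying [omega] replaces each [c_k] by [|c_k|],
    which gives [A_n]. Both sides are compared through the Newton-type recursion
    [n G_n = \sum_k k c_k p_k G_(n-k)] expressing the logarithmic derivative. *)

Require Import Defs.
From mathcomp Require Import all_boot all_order all_algebra.
From mathcomp Require Import mpoly ring lra zify.
Set Implicit Arguments.
Unset Strict Implicit.
Unset Printing Implicit Defensive.

Import Order.TTheory GRing.Theory Num.Theory.
Local Open Scope ring_scope.

(** * Polynomials modulo [X^(n+1)] *)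

Section TruncatedSeries.
Variable R : comNzRingType.
Implicit Types (p q r : {poly R}) (n : nat).

(** Power series are represented by polynomials compared up to degree [n], so each identity carries
    its own precision. *)
Definition eqm n p q := forall m, (m <= n)%N -> p`_m = q`_m.

Lemma eqm_refl n p : eqm n p p.
Proof. by []. Qed.

Lemma eqm_sym n p q : eqm n p q -> eqm n q p.
Proof. by move=> h m /h. Qed.

Lemma eqm_trans n q p r : eqm n p q -> eqm n q r -> eqm n p r.
Proof. by move=> h1 h2 m mn; rewrite h1 // h2. Qed.

Lemma eqm_le n n' p q : (n' <= n)%N -> eqm n p q -> eqm n' p q.
Proof. by move=> n'n h m mn; apply: h; apply: leq_trans n'n. Qed.

Lemma eqmD n p p' q q' : eqm n p p' -> eqm n q q' -> eqm n (p + q) (p' + q').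
Proof. by move=> h1 h2 m mn; rewrite !coefD h1 // h2. Qed.

Lemma eqmN n p p' : eqm n p p' -> eqm n (- p) (- p').
Proof. by move=> h1 m mn; rewrite !coefN h1. Qed.

Lemma eqmM n p p' q q' : eqm n p p' -> eqm n q q' -> eqm n (p * q) (p' * q').
Proof.
move=> h1 h2 m mn; rewrite !coefM; apply: eq_bigr => i _.
rewrite h1 ?h2 //; first by apply: leq_trans (leq_subr _ _) mn.
by apply: leq_trans mn; rewrite -ltnS.
Qed.

Lemma eqm_prod n (I : Type) (s : seq I) (F G : I -> {poly R}) :
  (forall i, eqm n (F i) (G i)) -> eqm n (\prod_(i <- s) F i) (\prod_(i <- s) G i).
Proof.
by move=> h; elim: s => [|i s IHs]; rewrite ?big_nil ?big_cons //; apply: eqmM.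
Qed.

(** The Euler operator replaces the derivative because it preserves degrees: no precision is lost in
    [eqm_theta]. *)
Definition theta p := 'X * p^`().

Lemma coef_theta p m : (theta p)`_m = p`_m *+ m.
Proof. by case: m => [|m]; rewrite /theta coefXM ?mulr0n // coef_deriv. Qed.

Lemma thetaM p q : theta (p * q) = theta p * q + p * theta q.
Proof. by rewrite /theta derivM; ring. Qed.

Lemma eqm_theta n p q : eqm n p q -> eqm n (theta p) (theta q).
Proof. by move=> h m mn; rewrite !coef_theta h. Qed.

(** Logarithmic derivatives add up over a product; the form [D i * F i] avoids dividing by [F i]. *)
Lemma theta_prod n (I : Type) (s : seq I) (F D : I -> {poly R}) :
  (forall i, eqm n (theta (F i)) (D i * F i)) ->
  eqm n (theta (\prod_(i <- s) F i)) ((\sum_(i <- s) D i) * \prod_(i <- s) F i).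
Proof.
move=> h; elim: s => [|i s IHs].
  by rewrite !big_nil /theta -polyC1 derivC mulr0 mul0r.
rewrite !big_cons thetaM.
have -> : (D i + \sum_(j <- s) D j) * (F i * \prod_(j <- s) F j) =
  (D i * F i) * \prod_(j <- s) F j
    + F i * ((\sum_(j <- s) D j) * \prod_(j <- s) F j) by ring.
by apply: eqmD; apply: eqmM.
Qed.

End TruncatedSeries.
Arguments eqm_trans {R n} q [p r].

(** Cancelling a factor of order exactly [k] costs [k] degrees. In coefficient [m + k] the terms
    with [i < m] agree by induction and those with [i > m] vanish, which leaves only the term with
    the nonzero factor [q_k]. *)
Lemma eqm_mulIf (F : fieldType) n k (q p r : {poly F}) :
  (forall i, (i < k)%N -> q`_i = 0) -> q`_k != 0 ->
  eqm (n + k)%N (p * q) (r * q) -> eqm n p r.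
Proof.
move=> q0 qk h m; elim/ltn_ind: m => m IHm mn.
have /h : (m + k <= n + k)%N by rewrite leq_add2r.
have mk : (m < (m + k).+1)%N by rewrite ltnS leq_addr.
rewrite !coefM (bigD1 (Ordinal mk)) // [RHS](bigD1 (Ordinal mk)) //=.
rewrite addKn => /(congr1 (fun x => x - \sum_(i < (m + k).+1 | i != Ordinal mk)
  r`_i * q`_(m + k - i))).
rewrite addrK (eq_bigr (fun i : 'I_(m + k).+1 => r`_i * q`_(m + k - i))).
  by rewrite addrK => /(mulIf qk).
move=> i; rewrite -val_eqE /= neq_ltn => /orP[im|im].
  by rewrite IHm // (leq_trans (ltnW im)).
by rewrite q0 ?mulr0 // ltn_subLR ?ltn_add2r // -ltnS.
Qed.

(** * Bernoulli numbers and the hyperbolic tangent *)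

Definition exps n (a : rat) : {poly rat} := \poly_(j < n.+1) (a ^+ j / j`!%:R).

Lemma fact_neq0 n : n`!%:R != 0 :> rat.
Proof. by rewrite pnatr_eq0 -lt0n fact_gt0. Qed.

Lemma coef_exps n a j : (j <= n)%N -> (exps n a)`_j = a ^+ j / j`!%:R.
Proof. by rewrite coef_poly ltnS => ->. Qed.

Lemma binQ n k : (k <= n)%N -> 'C(n, k)%:R = n`!%:R / (k`!%:R * (n - k)`!%:R) :> rat.
Proof.
by move=> kn; rewrite -(bin_fact kn) !natrM mulfK // mulf_neq0 ?fact_neq0.
Qed.

Lemma expsD n a b : eqm n (exps n a * exps n b) (exps n (a + b)).
Proof.
move=> m mn; rewrite coefM coef_exps // exprDn mulr_suml.
rewrite (reindex_inj rev_ord_inj) /=; apply: eq_bigr => i _.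
have im : (i <= m)%N by rewrite -ltnS.
rewrite subSS subKn // !coef_exps ?(leq_trans im) ?(leq_trans (leq_subr _ _)) //.
rewrite -[_ *+ 'C(_, _)]mulr_natr binQ //; move: (fact_neq0 m) (fact_neq0 i) (fact_neq0 (m - i)).
by move=> h1 h2 h3; field; rewrite ?h1 ?h2 ?h3.
Qed.

Lemma exps0 n : eqm n (exps n 0) 1.
Proof.
move=> m mn; rewrite coef_exps // coef1 expr0n.
by case: m {mn} => [|m]; rewrite ?mul0r // fact0 divr1.
Qed.

(** Truncation of [aX / (exp (aX) - 1)]. *)
Definition bern n (a : rat) : {poly rat} :=
  \poly_(j < n.+1) (a ^+ j * bernoulli j / j`!%:R).

Lemma bern_exps n a : eqm n (bern n a * (exps n a - 1)) (a *: 'X).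
Proof.
move=> m mn; rewrite coefM coefZ coefX big_ord_recr /= subnn.
rewrite coefB coef_exps // coef1 fact0 expr0 divr1 subrr mulr0 addr0.
case: m mn => [|m] mn; first by rewrite big_ord0 mulr0.
rewrite eqSS -bernoulli_rec big_distrr /=.
rewrite (eq_bigr (fun i : 'I_m.+1 => a ^+ m.+1 / m.+1`!%:R *
   ('C(m.+1, i)%:R * bernoulli i))); last first.
  move=> i _; have im : (i < m.+1)%N by [].
  rewrite coef_poly ltnS (leq_trans (ltnW im) mn) coefB coef_exps; last first.
    exact: leq_trans (leq_subr _ _) mn.
  rewrite coef1 subn_eq0 leqNgt im subr0 (binQ (ltnW im)).
  have -> : a ^+ m.+1 = a ^+ (m.+1 - i) * a ^+ i by rewrite -exprD subnK // ltnW.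
  move: (fact_neq0 m.+1) (fact_neq0 i) (fact_neq0 (m.+1 - i)).
  by move=> h1 h2 h3; field; rewrite ?h1 ?h2 ?h3.
rewrite -!big_distrr /= bernoulli_rec.
by case: m {mn} => [|m]; rewrite ?mulr0 //= expr1 divr1.
Qed.

(* The coefficient of [x^(2j)] in [(x / 2) tanh x]. *)
Definition tanh_coef j : rat :=
  4 ^+ j * (4 ^+ j - 1) * bernoulli (2 * j) / (2 * (2 * j)`!%:R).

Lemma tanh_coef0 : tanh_coef 0 = 0.
Proof. by rewrite /tanh_coef expr0 subrr mulr0 !mul0r. Qed.

(** Coefficient of [t^k] in [cosh (sqrt t)]. *)
Definition cosh_coef k : rat := (2 * k)`!%:R^-1.

Lemma exps_double n : eqm n (exps n 2 * exps n 2) (exps n 4).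
Proof. by have := @expsD n 2 2; rewrite (_ : 2 + 2 = 4 :> rat). Qed.

(* [B(4x) - B(2x) + x = x tanh x] for [B(x) = x / (exp x - 1)], with the
   denominator [exp (2x) + 1] cleared. *)
Lemma bern_tanh n :
  eqm n ((bern n.+1 4 - bern n.+1 2 + 'X) * (exps n.+1 2 + 1))
          ('X * (exps n.+1 2 - 1)).
Proof.
set E := exps _ 2; set B4 := bern _ 4; set B2 := bern _ 2.
have h4 : eqm n.+1 (B4 * (E * E - 1)) (4 *: 'X).
  apply: eqm_trans (@bern_exps n.+1 4).
  by apply: eqmM => //; apply: eqmD => //; apply: exps_double.
have h2 : eqm n.+1 (B2 * (E - 1)) (2 *: 'X) by apply: bern_exps.
(* Multiplied by [E - 1], which has order 1, the identity becomes [4X - 2X (E + 1) + X (E^2 - 1) = X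
   (E - 1)^2]; cancelling [E - 1] costs one degree. *)
apply: (@eqm_mulIf _ _ 1 (E - 1)).
- case=> // _; rewrite coefB coef1 coef_exps // expr0 fact0 divr1 subrr //.
- by rewrite coefB coef1 coef_exps //= subr0.
rewrite addn1.
have -> : (B4 - B2 + 'X) * (E + 1) * (E - 1) =
  B4 * (E * E - 1) - B2 * (E - 1) * (E + 1) + 'X * (E + 1) * (E - 1) by ring.
apply: (eqm_trans (4 *: 'X - 2 *: 'X * (E + 1) + 'X * (E + 1) * (E - 1))).
  apply: eqmD => //; apply: eqmD => //; apply: eqmN; exact: eqmM.
have -> : 4 *: 'X - 2 *: 'X * (E + 1) + 'X * (E + 1) * (E - 1) =
  'X * (E - 1) * (E - 1).
  rewrite !scaler_nat; ring.
exact: eqm_refl.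
Qed.

Lemma sum_even_ord (V : zmodType) m (f : nat -> V) :
  (forall j, (j < m)%N -> f (2 * j).+1 = 0) ->
  \sum_(i < (2 * m).+1) f i = \sum_(j < m.+1) f (2 * j)%N.
Proof.
elim: m => [|m IHm] f0; first by rewrite muln0 !big_ord1.
rewrite mulnS [LHS]big_ord_recr big_ord_recr /= f0 // addr0 IHm; last first.
  by move=> j jm; apply: f0; rewrite ltnS ltnW.
by rewrite [RHS]big_ord_recr /= mulnS.
Qed.

(** Multiplying [bern_tanh] by [exp (-x)] gives [W (exp x + exp (-x)) = x (exp x - exp (-x))]; its
    coefficient in degree [2k] is the equation [theta U = D U] for [U = cosh (sqrt t)]. *)
Lemma tanh_cosh k :
  k%:R * cosh_coef k = \sum_(j < k.+1) tanh_coef j * cosh_coef (k - j).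
Proof.
case: k => [|k]; first by rewrite mul0r big_ord1 tanh_coef0 mul0r.
pose n := (2 * k.+1)%N.
pose W : {poly rat} := bern n.+1 4 - bern n.+1 2 + 'X.
pose e1 := exps n.+1 1; pose f1 := exps n.+1 (-1).
have e1f1 : eqm n (e1 * f1) 1.
  apply: eqm_trans (eqm_le (leqnSn n) (@exps0 n.+1)).
  by apply: (eqm_le (leqnSn n)); have := @expsD n.+1 1 (-1); rewrite subrr.
have e2f1 : eqm n (exps n.+1 2 * f1) e1.
  apply: (eqm_le (leqnSn n)); have := @expsD n.+1 2 (-1).
  by rewrite (_ : 2 - 1 = 1 :> rat).
have key : eqm n (W * (e1 + f1)) ('X * (e1 - f1)).
  apply: (eqm_trans (W * ((exps n.+1 2 + 1) * f1))).
    apply: eqmM => //; rewrite mulrDl mul1r; apply: eqmD => //; exact: eqm_sym.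
  rewrite mulrA; apply: (eqm_trans ('X * (exps n.+1 2 - 1) * f1)).
    by apply: eqmM => //; apply: bern_tanh.
  rewrite -mulrA mulrBl mul1r; apply: eqmM => //; exact: eqmD.
have := key n (leqnn n); rewrite coefXM coefM.
have nE : n = (2 * k).+2 by rewrite /n mulnS.
have -> : (n == 0)%N = false by rewrite nE.
have -> : n.-1 = (2 * k).+1 by rewrite nE.
rewrite [in RHS]coefB !coef_exps ?nE ?ltnS ?leqW //.
rewrite -nE => keyn.
have coefEF i : (i <= n)%N -> (e1 + f1)`_i = (1 + (-1) ^+ i) / i`!%:R.
  by move=> ni; rewrite coefD !coef_exps ?expr1n ?mulrDl // leqW.
(* Odd coefficients of [exp x + exp (-x)] vanish and [n] is even, so only even indices of [W]
   remain. *)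
move: keyn; rewrite (@sum_even_ord _ k.+1 (fun i => W`_i * (e1 + f1)`_(n - i))) => [|j jk]; last first.
  rewrite coefEF ?leq_subr // -signr_odd oddB; last by rewrite /n; lia.
  by rewrite /n !mul2n oddS !odd_double expr1 subrr mul0r mulr0.
rewrite (eq_bigr (fun j : 'I_k.+2 => 4 * (tanh_coef j * cosh_coef (k.+1 - j)))).
  rewrite -mulr_sumr expr1n -[(-1) ^+ _]signr_odd mul2n oddS odd_double expr1.
  rewrite -mul2n => h; rewrite {1}/cosh_coef; move: h.
  have -> : (2 * k.+1)`!%:R = 2 * k.+1%:R * (2 * k).+1`!%:R :> rat.
    by rewrite -!natrM mulnS; congr _%:R; apply: (factS (2 * k).+1).
  have := fact_neq0 (2 * k).+1; have : k.+1%:R != 0 :> rat by rewrite pnatr_eq0.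
  move: (k.+1%:R : rat) ((2 * k).+1`!%:R : rat) => x y x0 y0 h.
  apply: (@mulfI _ 4) => //; rewrite h; field; by rewrite x0 y0.
move=> j _; have jk : (j <= k.+1)%N by rewrite -ltnS.
rewrite coefEF ?leq_subr // /n -mulnBr -signr_odd [in odd _]mul2n odd_double.
rewrite /W coefD coefB coefX !coef_poly !ltnS.
have -> : (2 * j <= n.+1)%N by rewrite /n; lia.
have -> : (2 * j == 1)%N = false by lia.
rewrite addr0 /tanh_coef /cosh_coef.
have -> : 4 ^+ (2 * j) = 4 ^+ j * 4 ^+ j :> rat by rewrite -exprD addnn mul2n.
have -> : 2 ^+ (2 * j) = 4 ^+ j :> rat by rewrite exprM.
have := fact_neq0 (2 * j); have := fact_neq0 (2 * (k.+1 - j)).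
by move=> h1 h2; field; rewrite h1 h2.
Qed.

(* [theta D = t / 4 + D / 2 - D ^ 2] for [D (x ^ 2) = (x / 2) tanh x], from
   [tanh' = 1 - tanh ^ 2]. *)
Lemma tanh_riccati j :
  (j%:R - 2^-1) * tanh_coef j =
  (j == 1%N)%:R / 4 - \sum_(i < j.+1) tanh_coef i * tanh_coef (j - i).
Proof.
pose U : {poly rat} := \poly_(i < j.+1) cosh_coef i.
pose D : {poly rat} := \poly_(i < j.+1) tanh_coef i.
have UE i : (i <= j)%N -> U`_i = cosh_coef i by rewrite coef_poly ltnS => ->.
have DE i : (i <= j)%N -> D`_i = tanh_coef i by rewrite coef_poly ltnS => ->.
have UD : eqm j (theta U) (D * U).
  move=> m mj; rewrite coef_theta UE // -mulr_natl tanh_cosh coefM.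
  apply: eq_bigr => i _; rewrite UE ?DE //.
    by rewrite (leq_trans _ mj) // -ltnS.
  exact: leq_trans (leq_subr _ _) mj.
(* The equation [cosh'' = cosh] in the variable [t = x^2]. *)
have UU : eqm j (theta (theta U)) (4^-1 *: ('X * U) + 2^-1 *: theta U).
  move=> m mj; rewrite coefD !coefZ !coef_theta coefXM UE //.
  case: m mj => [|m] mj /=; first by rewrite !mulr0n !mulr0 addr0.
  rewrite UE ?(ltnW mj) // /cosh_coef mulnS add2n !factS !natrM.
  have := fact_neq0 (2 * m).
  have h2 : (2 * m).+2%:R = 2 * m%:R + 2 :> rat by rewrite -natrM -natrD addn2.
  have h1 : (2 * m).+1%:R = 2 * m%:R + 1 :> rat by rewrite -natrM natr1.
  have e x : x *+ m.+1 = x * (m%:R + 1) :> rat by rewrite natr1 mulr_natr.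
  rewrite !e h1 h2.
  have : 0 <= m%:R :> rat by rewrite ler0n.
  by move: (m%:R) => x x0 f0; field; rewrite f0 /=; apply/andP; split; lra.
(* Applying [theta] to [theta U = D U] gives [theta (theta U) = (theta D + D^2) U]; then [U], with
   constant term 1, is cancelled. *)
have ricc : eqm j (theta D + D * D) (4^-1 *: 'X + 2^-1 *: D).
  apply: (@eqm_mulIf _ _ 0 U) => //; first by rewrite UE // /cosh_coef invr_neq0.
  rewrite addn0; apply: (eqm_trans (theta (theta U))).
    refine (eqm_sym (eqm_trans (theta (D * U)) (eqm_theta UD) _)); rewrite thetaM.
    rewrite mulrDl -[D * D * U]mulrA; apply: eqmD => //.
    exact: eqmM.
  refine (eqm_trans _ UU _); rewrite mulrDl -!scalerAl; apply: eqmD => //.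
  by move=> m mj; rewrite !coefZ UD.
have := ricc j (leqnn j); rewrite !coefD coef_theta !coefZ coefX coefM DE // => h.
have sumE : \sum_(i < j.+1) D`_i * D`_(j - i) =
    \sum_(i < j.+1) tanh_coef i * tanh_coef (j - i).
  by apply: eq_bigr => i _; rewrite !DE ?leq_subr // -ltnS.
move: h; rewrite sumE -[tanh_coef j *+ j]mulr_natl.
move: (\sum_(i < _) _) ((j == 1)%:R : rat) (j%:R : rat) => y z x h.
by rewrite mulrBl [z / 4]mulrC; move: h; move: (x * _) => w; lra.
Qed.

(** Strong induction on the Riccati recursion: the factor [j + 1 - 1/2] is positive, the term [1/4]
    occurs only for [j = 0], and each product in the convolution has sign [(-1)^(j-1)], turned into
    [(-1)^j] by the minus sign. *)
Lemma tanh_coef_sign j : 0 <= (-1) ^+ j * tanh_coef j.+1.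
Proof.
elim/ltn_ind: j => j IHj.
have := tanh_riccati j.+1.
rewrite big_ord_recl tanh_coef0 mul0r add0r big_ord_recr /= subnn tanh_coef0.
rewrite mulr0 addr0 => ricc.
suff: 0 <= (j.+1%:R - 2^-1) * ((-1) ^+ j * tanh_coef j.+1).
  rewrite pmulr_rge0 // subr_gt0 (@lt_le_trans _ _ 1) //.
  by rewrite (ler_nat _ 1).
rewrite mulrCA ricc mulrBr eqSS -mulrN -sumrN mulr_sumr addr_ge0 //.
  by case: (j) => [|i]; rewrite ?mul0r ?mulr0 // expr0 mul1r.
apply: sumr_ge0 => i _; rewrite /bump /= add1n subSS.
have ij := ltn_ord i; have ji : ((j - i).-1 < j)%N by lia.
have := mulr_ge0 (IHj i ij) (IHj _ ji); rewrite prednK ?subn_gt0 //.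
rewrite mulrACA -exprD; suff -> : (-1) ^+ j = - (-1) ^+ (i + (j - i).-1) :> rat.
  by rewrite mulNr mulrN opprK.
by rewrite -[RHS]mulN1r -exprS; congr (_ ^+ _); lia.
Qed.

(** * Newton identities *)

(** The outer variable records the degree in ['X_i], so coefficient [k] of a product over [i] is its
    homogeneous part of degree [k]. *)
Definition var_series N B (u : nat -> rat) (i : 'I_N) : {poly {mpoly rat[N]}} :=
  \poly_(j < B.+1) (u j *: 'X_i ^+ j).

(** In the expanded product the monomial [m] arises from a single choice of exponents, [m i] in
    factor [i]; [k <= B] keeps them within the truncation. *)
Lemma mcoeff_prod_series N B u k (m : 'X_{1..N}) : (k <= B)%N ->
  ((\prod_(i < N) var_series B u i)`_k)@_m = (mdeg m == k)%:R * \prod_i u (m i).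
Proof.
move=> kB; rewrite (eq_bigr (fun i => \sum_(j < B.+1) (u j *: 'X_i ^+ j) *: 'X^j)).
  rewrite bigA_distr_bigA /=.
  rewrite (eq_bigr (fun f : {ffun 'I_N -> 'I_B.+1} =>
     ((\prod_i u (f i)) *: 'X_[[multinom (f i : nat) | i < N]])
        *: 'X^(\sum_i f i))); last first.
    move=> f _; rewrite scaler_prod prodrXr scaler_prod mpolyXE_id.
    by congr (_ *: _ *: _); apply: eq_bigr => i _; rewrite mnmE.
  rewrite coef_sumMXn raddf_sum /=.
  have term (f : {ffun 'I_N -> 'I_B.+1}) :
      ((\prod_i u (f i)) *: 'X_[[multinom (f i : nat) | i < N]] : {mpoly rat[N]})@_m
      = ([multinom (f i : nat) | i < N] == m)%:R * \prod_i u (m i).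
    rewrite mcoeffZ mcoeffX mulrC; case: eqP => [<-|_]; last by rewrite !mul0r.
    by congr (_ * _); apply: eq_bigr => i _; rewrite mnmE.
  rewrite (eq_bigr _ (fun f _ => term f)) -mulr_suml; congr (_ * _).
  have [mk|mk] := eqVneq (mdeg m) k; last first.
    rewrite big1 // => f /eqP fk; case: eqP => // fm.
    case/eqP: mk; rewrite -fk -fm mdegE.
    by apply: eq_bigr => i _; rewrite mnmE.
  have mB i : (m i < B.+1)%N.
    rewrite ltnS (leq_trans _ kB) // -mk mdegE (bigD1 i) //= leq_addr //.
  pose f0 : {ffun 'I_N -> 'I_B.+1} := [ffun i => Ordinal (mB i)].
  rewrite (bigD1 f0) /=; last first.
    by rewrite -mk mdegE; apply/eqP/eq_bigr => i _; rewrite ffunE.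
  rewrite (_ : [multinom _ | _ < _] = m); last first.
    by apply/mnmP => i; rewrite mnmE ffunE.
  rewrite eqxx big1 ?addr0 // => f /andP[_ ff0]; case: eqP => // fm.
  case/eqP: ff0; apply/ffunP => i; apply: val_inj.
  by rewrite ffunE /= -fm mnmE.
by move=> i _; rewrite /var_series poly_def.
Qed.

(** [G k] is the degree [k] part of [u(x_0) u(x_1) ...], and the second hypothesis is
    [theta u = d u]. So the logarithmic derivative of the product is [sum_i d(x_i)], whose degree
    [j] part is [d_j p_j]. *)
Lemma sf_newton (G : nat -> symfun) (u d : nat -> rat) :
  d 0%N = 0 ->
  (forall k, k%:R * u k = \sum_(j < k.+1) d j * u (k - j)%N) ->
  (forall N k m, (G k N)@_m = (mdeg m == k)%:R * \prod_i u (m i)) ->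
  forall k, k.+1%:R *: G k.+1 = \sum_(j < k.+1) d j.+1 *: (sf_p j * G (k - j)%N).
Proof.
move=> d0 ud Gu k; apply: symfunP => N; rewrite -[RHS]/(sf_proj N _) raddf_sum /=.
pose B := k.+1; pose F := \prod_(i < N) var_series B u i.
pose D := \sum_(i < N) var_series B d i.
have FG j : (j <= B)%N -> F`_j = G j N.
  by move=> jB; apply/mpolyP => m; rewrite mcoeff_prod_series // Gu.
have FD : eqm B (theta F) (D * F).
  apply: theta_prod => i m mB; rewrite coef_theta coefM /var_series coef_poly ltnS mB.
  rewrite -scaler_nat scalerA ud scaler_suml; apply: eq_bigr => j _.
  have jm : (j <= m)%N by rewrite -ltnS.
  rewrite !coef_poly !ltnS (leq_trans jm mB) (leq_trans (leq_subr _ _) mB).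
  by rewrite -scalerAl -scalerAr scalerA -exprD subnKC.
have D0 : D`_0 = 0.
  by rewrite /D coef_sum big1 // => i _; rewrite /var_series coef_poly /= d0 scale0r.
have := FD B (leqnn B); rewrite coef_theta FG // coefM big_ord_recl D0.
rewrite mul0r add0r -scaler_nat => ->; apply: eq_bigr => j _.
rewrite /= /bump add1n subSS FG ?(leq_trans (leq_subr _ _)) //.
have -> : D`_j.+1 = d j.+1 *: \sum_(i < N) 'X_i ^+ j.+1.
  rewrite /D coef_sum scaler_sumr; apply: eq_bigr => i _.
  by rewrite /var_series coef_poly ltnS ltn_ord.
by rewrite -scalerAl.
Qed.

(** The case [u = 1 / (1 - t)], [d = t / (1 - t)]. *)
Lemma h_newton k : k.+1%:R *: sf_h k.+1 = \sum_(j < k.+1) sf_p j * sf_h (k - j).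
Proof.
rewrite (@sf_newton sf_h (fun=> 1) (fun j => (j != 0)%:R)) //.
- by apply: eq_bigr => j _; rewrite scale1r.
- move=> k'; rewrite big_ord_recl mul0r add0r (eq_bigr (fun=> 1)).
    by rewrite sumr_const card_ord mulr1.
  by move=> j _; rewrite mulr1.
by move=> N k' m; rewrite /= mcoeff_hsym big1 ?mulr1.
Qed.

(** The case [u = 1 + t], [d = t / (1 + t)]. *)
Lemma e_newton k :
  k.+1%:R *: sf_e k.+1 = \sum_(j < k.+1) (-1) ^+ j *: (sf_p j * sf_e (k - j)).
Proof.
rewrite (@sf_newton sf_e (fun j => (j <= 1)%N%:R)
          (fun j => if j is j'.+1 then (-1) ^+ j' else 0)) //.
- case=> [|[|k']]; first by rewrite big_ord1 !mul0r.
    by rewrite big_ord_recl big_ord1 mul0r add0r /= !mul1r.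
  rewrite mulr0 big_ord_recl mul0r add0r !big_ord_recr /= big1 => [|j _].
    by rewrite add0r /bump /= !add1n subnn subSn // subnn !mulr1 exprS mulN1r subrr.
  rewrite /bump /= add1n; have jk := ltn_ord j.
  by rewrite leqNgt (_ : (_ < _)%N) ?mulr0 //; lia.
move=> N k' m; rewrite /= mcoeff_mesym /mechar.
rewrite -mulnb natrM; congr (_ * _).
have [/forallP h|] := boolP [forall i, (m i <= 1)%N]; first by rewrite big1 // => i _; rewrite h.
by rewrite negb_forall => /existsP[i /negbTE hi]; rewrite (bigD1 i) //= hi mul0r.
Qed.

(** [omega] turns [h_newton] into a recursion for [e]; by induction it matches [e_newton] term by
    term, except for the last term, which isolates [sf_p k]. *)
Lemma omega_p k : omega (sf_p k) = (-1) ^+ k *: sf_p k.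
Proof.
elim/ltn_ind: k => k IHk.
have := congr1 omega (h_newton k).
rewrite linearZ /= omega_h e_newton raddf_sum /= !big_ord_recr /= subnn.
rewrite rmorphM /= omega_h sf_e0 !mulr1.
rewrite (eq_bigr (fun i : 'I_k => omega (sf_p i * sf_h (k - i)))).
  by move=> /addrI.
by move=> i _; rewrite rmorphM /= omega_h IHk // -scalerAl.
Qed.

(** * Colour classes and their matching *)

Section ColorRank.
Variables (L : nat) (C : eqType) (c : 'I_L -> C).
Implicit Types (v w : 'I_L) (e f : {set 'I_L}) (M : {set {set 'I_L}}).

Definition fiber (i : C) := [set w | c w == i].

Definition rank v := #|[set w : 'I_L | (w < v)%N & c w == c v]|.

Lemma rank_lt v w : c v = c w -> (v < w)%N -> (rank v < rank w)%N.
Proof.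
move=> cvw vw; apply: proper_card; apply/properP; split.
  by apply/subsetP => x; rewrite !inE => /andP[xv /eqP ->]; rewrite cvw eqxx (ltn_trans xv).
by exists v; rewrite !inE ?vw ?cvw ?eqxx // ltnn.
Qed.

Lemma rank_ltE v w : c v = c w -> (rank v < rank w)%N = (v < w)%N.
Proof.
move=> cvw; have [vw|wv] := ltnP v w; first by rewrite rank_lt.
apply/negbTE; rewrite -leqNgt; move: wv; rewrite leq_eqVlt => /orP[/eqP wv|wv].
  by rewrite (val_inj wv).
exact/ltnW/rank_lt.
Qed.

Lemma rank_inj v w : c v = c w -> rank v = rank w -> v = w.
Proof.
move=> cvw rvw; apply: val_inj.
case: (ltngtP v w) => // lt; first by have := rank_lt cvw lt; rewrite rvw ltnn.
by have := rank_lt (esym cvw) lt; rewrite rvw ltnn.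
Qed.

Lemma rank_fiber v : (rank v < #|fiber (c v)|)%N.
Proof.
apply: proper_card; apply/properP; split.
  by apply/subsetP => x; rewrite !inE => /andP[].
by exists v; rewrite !inE ?ltnn ?eqxx.
Qed.

Lemma rank_onto i k : (k < #|fiber i|)%N -> exists2 v, c v = i & rank v = k.
Proof.
move=> ki; pose s := [seq rank v | v <- enum (fiber i)].
have us : uniq s.
  rewrite map_inj_in_uniq ?enum_uniq // => v w; rewrite !mem_enum !inE.
  by move=> /eqP cv /eqP cw; apply: rank_inj; rewrite cv cw.
have ss : {subset s <= iota 0 #|fiber i|}.
  move=> r /mapP[v]; rewrite mem_enum inE => /eqP <- ->.
  by rewrite mem_iota /= rank_fiber.
have [|_ sE] := uniq_min_size us ss; first by rewrite size_iota size_map cardE.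
have : k \in s by rewrite sE mem_iota.
by case/mapP => v; rewrite mem_enum inE => /eqP cv ->; exists v.
Qed.

Definition block_key v := (c v, (rank v)./2).

(* Pairs the first element of each colour class with the second, the third with
   the fourth, and so on. *)
Definition color_matching := preim_partition block_key [set: 'I_L].

Lemma color_matchingP e :
  reflect (exists v, e = [set w | block_key w == block_key v]) (e \in color_matching).
Proof.
apply: (iffP imsetP) => [[v _ ->]|[v ->]]; exists v => //;
  by apply/setP => w; rewrite !inE eq_sym.
Qed.

Lemma color_matching_perfect :
  (forall i, ~~ odd #|fiber i|) -> is_perfect_matching color_matching.
Proof.
move=> ev; rewrite /is_perfect_matching preim_partitionP /=.
apply/forall_inP => _ /color_matchingP[v ->].
have rv := rank_fiber v; have := ev (c v) => evv.
(* The block of [v] consists of the ranks [2h] and [2h + 1], with [h] half the rank of [v] rounded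
   down; the second is attained because the class size is even. *)
have [|x cx rx] := @rank_onto (c v) (2 * (rank v)./2); first by lia.
have [|y cy ry] := @rank_onto (c v) (2 * (rank v)./2).+1; first by lia.
apply/cards2P; exists x, y; split; first by apply/eqP => xy; move: rx; rewrite xy ry; lia.
apply/setP => w; rewrite !inE /block_key xpair_eqE.
apply/idP/idP => [/andP[/eqP cw /eqP hw]|].
  have : rank w = rank x \/ rank w = rank y by rewrite rx ry; lia.
  by case=> /rank_inj ->; rewrite ?eqxx ?orbT ?cx ?cy ?cw.
by case/orP=> /eqP ->; rewrite ?cx ?cy ?rx ?ry eqxx /=; lia.
Qed.

Definition set_lt e f := [forall a in e, forall b in f, (a < b)%N].

Lemma set_ltP e f : reflect {in e & f, forall a b : 'I_L, (a < b)%N} (set_lt e f).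
Proof.
apply: (iffP forall_inP) => [h a b ae bf|h a ae].
  by have /forall_inP/(_ b bf) := h a ae.
by apply/forall_inP => b bf; apply: h.
Qed.

(** For a perfect matching these [c] are the vertex colourings induced by proper colourings of the
    incomparability graph, see [chain_coloringE]. *)
Definition chain_coloring M :=
  [forall e in M, forall f in M, forall x in e, forall y in f,
     if e == f then c x == c y else (c x == c y) ==> set_lt e f || set_lt f e].

Lemma chain_coloringP M : reflect
  ({in M, forall e, {in e &, forall x y, c x = c y}} /\
   {in M &, forall e f x y, x \in e -> y \in f -> c x = c y -> e != f ->
      set_lt e f \/ set_lt f e})
  (chain_coloring M).
Proof.
apply: (iffP forall_inP) => [h|[h1 h2] e eM]; last first.
  apply/forall_inP => f fM; apply/forall_inP => x xe; apply/forall_inP => y yf.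
  have [ef|ef] := eqVneq e f; first by apply/eqP/(h1 _ eM) => //; rewrite ef.
  by apply/implyP => /eqP cxy; apply/orP; apply: (h2 e f eM fM x y).
split=> [e eM x y xe ye|e f eM fM x y xe yf cxy ef].
  have /forall_inP/(_ e eM)/forall_inP/(_ x xe)/forall_inP/(_ y ye) := h e eM.
  by rewrite eqxx => /eqP.
have /forall_inP/(_ f fM)/forall_inP/(_ x xe)/forall_inP/(_ y yf) := h e eM.
by rewrite (negbTE ef) cxy eqxx => /orP.
Qed.

Lemma color_matching_chain : chain_coloring color_matching.
Proof.
apply/chain_coloringP; split=> [_ /color_matchingP[v ->] x y|].
  by rewrite !inE !xpair_eqE => /andP[/eqP -> _] /andP[/eqP -> _].
move=> _ _ /color_matchingP[v ->] /color_matchingP[w ->] x y.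
rewrite !inE !xpair_eqE => /andP[/eqP cx /eqP rx] /andP[/eqP cy /eqP ry] cxy vw.
have cvw : c v = c w by rewrite -cx -cy.
have hvw : (rank v)./2 != (rank w)./2.
  by apply: contra vw => /eqP hvw; apply/eqP/setP => z; rewrite !inE /block_key hvw cvw.
have lt p q : c p = c q -> ((rank p)./2 < (rank q)./2)%N ->
    set_lt [set z | block_key z == block_key p] [set z | block_key z == block_key q].
  move=> cpq hpq; apply/set_ltP => a b; rewrite !inE !xpair_eqE.
  move=> /andP[/eqP ca /eqP ra] /andP[/eqP cb /eqP rb].
  by rewrite -rank_ltE ?ca ?cb //; lia.
by move: hvw; rewrite neq_ltn => /orP[] h; [left|right]; apply: lt.
Qed.

Lemma perfect_matching_mate M e v : is_perfect_matching M -> e \in M -> v \in e ->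
  exists2 w, w != v & e = [set v; w].
Proof.
case/andP=> _ /forall_inP h /h /cards2P[x [y [xy ->]]].
rewrite !inE => /orP[] /eqP ->; first by exists y; rewrite // eq_sym.
by exists x; rewrite // setUC.
Qed.

Section Unique.
Variable M : {set {set 'I_L}}.
Hypotheses (Mperf : is_perfect_matching M) (Mchain : chain_coloring M).

Let Mpart : partition M [set: 'I_L]. Proof. by case/andP: Mperf. Qed.
Let Mtriv : trivIset M. Proof. by case/and3P: Mpart. Qed.

Lemma pblock_matching v : pblock M v \in M /\ v \in pblock M v.
Proof.
have vM : v \in cover M by case/and3P: Mpart => /eqP -> _ _; rewrite inE.
by rewrite pblock_mem // mem_pblock.
Qed.

Lemma matching_eq e f v : e \in M -> f \in M -> v \in e -> v \in f -> e = f.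
Proof. by move=> eM fM ve vf; rewrite -(def_pblock Mtriv eM ve) (def_pblock Mtriv fM vf). Qed.

(** Every other edge of the same colour lies wholly before [v] or wholly after [w]. Hence the class
    members before [v] fill whole edges, so their number is even, and none lies between [v] and
    [w]. *)
Lemma rank_mate v w : [set v; w] \in M -> (v < w)%N ->
  ~~ odd (rank v) /\ rank w = (rank v).+1.
Proof.
move=> eM vw; have [h1 h2] := chain_coloringP _ Mchain.
have cvw : c v = c w by apply: h1 eM _ _ _ _; rewrite !inE eqxx ?orbT.
have sep x : c x = c v -> x != v -> x != w ->
    {in pblock M x, forall z : 'I_L, (z < v)%N} \/ {in pblock M x, forall z : 'I_L, (w < z)%N}.
  move=> cx xv xw; have [fM xf] := pblock_matching x.
  case: (h2 _ _ fM eM x v) => //; first by rewrite !inE eqxx.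
  - by apply: contraTneq xf => ->; rewrite !inE negb_or xv.
  - by move/set_ltP => h; left => z zf; apply: h; rewrite // !inE eqxx.
  by move/set_ltP => h; right => z zf; apply: h; rewrite // !inE eqxx orbT.
split.
  pose B := [set x : 'I_L | (x < v)%N & c x == c v].
  rewrite /rank -/B -sum1_card.
  rewrite (eq_bigl (fun x => (x \in [set: 'I_L]) && (x \in B))); last by move=> x; rewrite in_setT.
  rewrite (set_partition_big_cond _ Mpart) /=.
  elim/big_rec: _ => // f k fM ok; rewrite oddD (negbTE ok) addbF.
  have [x /andP[xf xB]|no] := pickP (fun x => (x \in f) && (x \in B)); last first.
    by rewrite big_pred0.
  move: (xB); rewrite inE => /andP[xv /eqP cx].
  have fE : pblock M x = f by rewrite (def_pblock Mtriv fM xf).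
  rewrite (eq_bigl (mem f)) => [|z].
    rewrite sum1_card; case/andP: Mperf => _ /forall_inP/(_ f fM) /eqP -> //.
  rewrite andb_idr // inE => zf; rewrite (h1 f fM z x) // cx eqxx andbT.
  have [||h|h] := sep x cx; last 2 first.
  - by apply: h; rewrite fE.
  - by have := h x; rewrite fE => /(_ xf) /(ltn_trans vw)/(ltn_trans xv); rewrite ltnn.
  - by apply: contraTneq xv => ->; rewrite ltnn.
  by apply: contraTneq xv => ->; rewrite -leqNgt ltnW.
rewrite /rank (_ : [set _ | _ & _] = v |: [set x : 'I_L | (x < v)%N & c x == c v]).
  by rewrite cardsU1 !inE ltnn.
apply/setP => x; rewrite !inE -cvw.
have [->|xv] /= := eqVneq x v; first by rewrite vw eqxx.
apply/andP/andP => -[xl /eqP cx]; split; rewrite ?cx //; last exact: ltn_trans vw.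
have [_ xf] := pblock_matching x; case: (sep x cx xv) => [|h|h]; last 2 first.
- exact: h.
- by have := ltn_trans xl (h x xf); rewrite ltnn.
by apply: contraTneq xl => ->; rewrite ltnn.
Qed.

Lemma rank_mate2 v w : [set v; w] \in M -> v != w ->
  c v = c w /\ (rank v)./2 = (rank w)./2.
Proof.
wlog vw : v w / (v < w)%N => [wl eM vw|eM _].
  move: (vw); rewrite -val_eqE neq_ltn => /orP[] lt; first exact: wl.
  by have [||->->] := wl w v lt; rewrite // 1?setUC // eq_sym.
have [h1 _] := chain_coloringP _ Mchain; have [ev ->] := rank_mate eM vw.
by split; [apply: h1 eM _ _ _ _; rewrite !inE eqxx ?orbT | lia].
Qed.

(** Only two ranks share a given half, and [v] and its mate take both, so no further vertex has the
    same key. *)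
Lemma block_key_pblock v w : (w \in pblock M v) = (block_key w == block_key v).
Proof.
have [eM ve] := pblock_matching v.
have [v' v'v eE] := perfect_matching_mate Mperf eM ve.
have [cv hv] : c v = c v' /\ (rank v)./2 = (rank v')./2.
  by apply: rank_mate2; rewrite -?eE // eq_sym.
rewrite eE !inE; apply/orP/idP => [[]/eqP->|]; rewrite ?/block_key -?cv -?hv //.
rewrite xpair_eqE => /andP[/eqP cw /eqP hw].
have rvv' : rank v <> rank v' by move/(rank_inj cv)/eqP; rewrite eq_sym (negbTE v'v).
have : rank w = rank v \/ rank w = rank v' by lia.
by case=> /rank_inj ->; rewrite -?cv ?eqxx; auto.
Qed.

Lemma color_matching_unique : M = color_matching.
Proof.
have blockE v : pblock M v = [set w | block_key w == block_key v].
  by apply/setP => w; rewrite block_key_pblock inE.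
apply/setP => e; apply/idP/color_matchingP => [eM|[v ->]]; last first.
  by rewrite -blockE; case: (pblock_matching v).
have [v ve] : exists v, v \in e.
  by apply/card_gt0P; case/andP: Mperf => _ /forall_inP/(_ e eM) /eqP ->.
by exists v; rewrite -blockE (def_pblock Mtriv eM ve).
Qed.

End Unique.
End ColorRank.

(** * The recursion for [A_n] *)

(** Absolute value of the coefficient of [t^(k+1)] in [log (cosh (sqrt t))]: [theta] of this
    logarithm is the series of [tanh_coef], with signs given by [tanh_coef_sign]. *)
Definition abs_coef k : rat := (-1) ^+ k * tanh_coef k.+1 / k.+1%:R.

Lemma abs_phi n (la : intpart n) :
  `|phi la| = (2 * n)`!%:R *
    \prod_(k < n) ((mult la k)`!%:R^-1 * abs_coef k ^+ mult la k).
Proof.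
rewrite /phi normrM normr_nat normr_prod; congr (_ * _); apply: eq_bigr => k _.
rewrite normrM normfV normr_nat normrX; congr (_ * _ ^+ _).
have -> : 4 ^+ k.+1 * (4 ^+ k.+1 - 1) * bernoulli (2 * k.+1) /
    ((2 * k.+1)%:R * (2 * k.+1)`!%:R) = tanh_coef k.+1 / k.+1%:R :> rat.
  rewrite /tanh_coef [(2 * k.+1)%:R]natrM; move: (4 ^+ _ * _ * _) => x.
  have := fact_neq0 (2 * k.+1); have : k.+1%:R != 0 :> rat by rewrite pnatr_eq0.
  by move: (k.+1%:R : rat) (_`!%:R : rat) => y z h1 h2; field; rewrite h1 h2.
rewrite normrM normfV normr_nat; congr (_ / _).
by rewrite -[RHS]ger0_norm ?tanh_coef_sign // [RHS]normrM normrX normrN1 expr1n mul1r.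
Qed.

(* [exp (|c_(k+1)| p_(k+1) X^(k+1))] modulo [X^(B+1)]. *)
Definition exp_series B k : {poly symfun} :=
  \poly_(i < B.+1) (if (k.+1 %| i)%N then
     (i %/ k.+1)`!%:R^-1 *: (abs_coef k *: sf_p k) ^+ (i %/ k.+1) else 0).

Lemma exp_series_le m B k : (m <= B)%N -> eqm m (exp_series m k) (exp_series B k).
Proof. by move=> mB i im; rewrite !coef_poly !ltnS im (leq_trans im). Qed.

Lemma exp_series_eq1 m B k : (m <= k)%N -> (m <= B)%N -> eqm m (exp_series B k) 1.
Proof.
move=> mk mB i im; rewrite coef_poly ltnS (leq_trans im mB) coef1.
case: i im => [|i] im; first by rewrite dvdn0 div0n fact0 invr1 scale1r.
by rewrite gtnNdvd // ltnS (leq_trans im).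
Qed.

(** Lets truncation order and number of factors vary together: a factor with index [k >= m] is 1 up
    to degree [m], since its next term has degree [k + 1]. *)
Lemma exp_series_prod_le m B : (m <= B)%N ->
  eqm m (\prod_(k < m) exp_series m k) (\prod_(k < B) exp_series B k).
Proof.
move=> mB; rewrite -!(big_mkord xpredT) (big_cat_nat (leq0n m) mB) /=.
rewrite -[X in eqm m X _]mulr1; apply: eqmM.
  by apply: eqm_prod => k; apply: exp_series_le.
have : all (leq m) (index_iota m B).
  by apply/allP => k; rewrite mem_index_iota => /andP[].
elim: (index_iota m B) => [|k s IHs] /=; first by rewrite big_nil.
case/andP=> mk /IHs ms; rewrite big_cons -[X in eqm m X _]mulr1; apply: eqmM => //.
by refine (eqm_sym _); apply: exp_series_eq1.
Qed.

Lemma theta_exp_series B k : eqm B (theta (exp_series B k))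
  ((k.+1%:R *: (abs_coef k *: sf_p k)) *: 'X^(k.+1) * exp_series B k).
Proof.
set a := abs_coef k *: sf_p k.
move=> m mB; rewrite coef_theta -scalerAl coefZ coefXnM !coef_poly ltnS mB.
have [mk|km] := ltnP m k.+1.
  rewrite mulr0; case: m mk mB => [|m] mk mB; first by rewrite mulr0n.
  by rewrite gtnNdvd // mul0rn.
rewrite ltnS (leq_trans (leq_subr _ _) mB) dvdn_subl //.
case: ifP => [/dvdnP[q mq]|_]; last by rewrite mul0rn mulr0.
rewrite mq; case: q mq => [|q] mq; first by rewrite mq in km.
rewrite mulnK // mulSn addKn mulnK // -mulSn.
rewrite -scalerAr -scalerAl -exprS -!scaler_nat !scalerA; congr (_ *: _).
rewrite factS !natrM.
have := fact_neq0 q; have : q.+1%:R != 0 :> rat by rewrite pnatr_eq0.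
move: (q.+1%:R : rat) (k.+1%:R : rat) (_`!%:R : rat) => y x z h1 h2.
by field; rewrite h1 h2.
Qed.

(** Expanding the product of exponentials chooses a multiplicity for each part size, and the
    exponent of [X] is the size of the resulting partition. *)
Lemma Asym_coef n : Asym n = (\prod_(k < n) exp_series n k)`_n.
Proof.
pose S k : {poly symfun} := \sum_(j < n.+1)
  (j`!%:R^-1 *: (abs_coef k *: sf_p k) ^+ j) *: 'X^(k.+1 * j).
have ES k : eqm n (exp_series n k) (S k).
  move=> i ni; rewrite coef_poly ltnS ni coef_sumMXn.
  case: ifP => [/dvdnP[q iq]|ki].
    have qn : (q < n.+1)%N.
      by rewrite ltnS (leq_trans _ ni) // iq leq_pmulr.
    rewrite (big_pred1 (Ordinal qn)) => [|j].
      by rewrite /= iq mulnK.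
    by rewrite iq [(q * _)%N]mulnC eqn_pmul2l // -val_eqE.
  rewrite big_pred0 // => j; apply: contraFF ki => /eqP <-; exact: dvdn_mulr.
rewrite (@eqm_prod _ n _ (index_enum 'I_n) (exp_series n) S ES n (leqnn n)).
rewrite bigA_distr_bigA /=.
rewrite (eq_bigr (fun f : {ffun 'I_n -> 'I_n.+1} =>
  (\prod_(k < n) ((f k)`!%:R^-1 *: (abs_coef k *: sf_p k) ^+ f k))
     *: 'X^(\sum_(k < n) k.+1 * f k))); last first.
  by move=> f _; rewrite scaler_prod prodrXr.
rewrite coef_sumMXn /Asym scaler_sumr.
rewrite [RHS](reindex_omap (val : intpart n -> _) insub) => [|f fn]; last first.
  by rewrite insubT.
apply: eq_big => [la|la _]; first by rewrite valK eqxx (valP la).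
rewrite abs_phi scalerA mulKf ?fact_neq0 // /sf_p_part -scaler_prod.
by apply: eq_bigr => k _; rewrite exprZn scalerA.
Qed.

Lemma Asym0 : Asym 0 = 1.
Proof. by rewrite Asym_coef big_ord0 coef1. Qed.

(** The logarithmic derivative of the product in [Asym_coef] is
    [sum_k (k+1) |c_(k+1)| p_(k+1) X^(k+1)], and [(k+1) |c_(k+1)|] is the signed [tanh_coef]. *)
Lemma Asym_rec n : n.+1%:R *: Asym n.+1 =
  \sum_(k < n.+1) ((-1) ^+ k * tanh_coef k.+1) *: (sf_p k * Asym (n - k)).
Proof.
have := @theta_prod _ n.+1 _ (index_enum 'I_n.+1) (exp_series n.+1 \o val) _
  (fun k => @theta_exp_series n.+1 k) n.+1 (leqnn _).
rewrite coef_theta -Asym_coef scaler_nat => ->.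
rewrite mulr_suml coef_sum; apply: eq_bigr => k _.
rewrite -scalerAl coefZ coefXnM ltnNge ltn_ord /= subSS.
(* Coefficient [n - k] is the same in the product for [n + 1] as in the one for [n - k], which is
   [Asym (n - k)]. *)
rewrite -(@exp_series_prod_le (n - k)) // -?Asym_coef; last first.
  by rewrite (leq_trans (leq_subr _ _)).
rewrite scalerA scalerAl; congr (_ *: _ * _).
by rewrite /abs_coef mulrCA divff ?mulr1 ?pnatr_eq0.
Qed.

(** * The sum over all matchings *)

Lemma mcoeffMX_eq0 N (p : {mpoly rat[N]}) (i : 'I_N) (a : 'X_{1..N}) :
  a i = 0%N -> (p * 'X_i)@_a = 0.
Proof.
move=> ai; apply: memN_msupp_eq0; apply/negP => /msuppM_le /allpairsP[[u v] /= [_]].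
rewrite msuppX inE => /eqP -> aE.
by move: ai; rewrite aE mnmDE mnm1E eqxx addn1.
Qed.

(** The multinomial theorem with denominators cleared; splitting off the last factor reduces the
    induction step to [sum_i a_i = K + 1]. *)
Lemma mcoeff_sumX_exp N K (a : 'X_{1..N}) :
  ((\sum_(i < N) 'X_i : {mpoly rat[N]}) ^+ K)@_a * \prod_i (a i)`!%:R
    = (mdeg a == K)%:R * K`!%:R.
Proof.
elim: K a => [|K IHK] a.
  rewrite expr0 mcoeff1 mdeg_eq0 mulr1; case: eqP => [->|_]; last by rewrite mul0r.
  by rewrite big1 ?mulr1 // => i _; rewrite mnm0E.
rewrite exprSr mulr_sumr raddf_sum /= mulr_suml.
rewrite (eq_bigr (fun i => (a i)%:R * ((mdeg a == K.+1)%:R * K`!%:R))) => [|i _].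
  rewrite -mulr_suml -natr_sum -mdegE.
  have [->|_] := eqVneq (mdeg a) K.+1; last by rewrite !mul0r mulr0.
  by rewrite !mul1r factS natrM.
have [ai|ai] := eqVneq (a i) 0%N; first by rewrite mcoeffMX_eq0 // ai !mul0r.
have aE : a = (U_(i) + (a - U_(i)))%MM by rewrite addmC submK // lep1mP.
set b := (a - U_(i))%MM in aE; rewrite aE mcoeffMX mdegD mdeg1 add1n eqSS -IHK.
rewrite mulrCA; congr (_ * _).
rewrite (bigD1 i) //= [in RHS](bigD1 i) //= mulrA; congr (_ * _).
  by rewrite mnmDE mnm1E eqxx add1n factS natrM.
by apply: eq_bigr => j ji; rewrite mnmDE mnm1E eq_sym (negbTE ji).
Qed.

Definition coloring_mnm L N (c : {ffun 'I_L -> 'I_N}) : 'X_{1..N} :=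
  (\sum_v U_(c v))%MM.

Lemma coloring_mnmE L N (c : {ffun 'I_L -> 'I_N}) i :
  coloring_mnm c i = #|fiber c i|.
Proof.
rewrite /coloring_mnm mnm_sumE -sum1_card big_mkcond [RHS]big_mkcond /=.
by apply: eq_bigr => v _; rewrite mnm1E inE; case: eqP.
Qed.

Lemma count_colorings L N (a : 'X_{1..N}) :
  \sum_(c : {ffun 'I_L -> 'I_N}) (coloring_mnm c == a)%:R
    = (mdeg a == L)%:R * L`!%:R / \prod_i (a i)`!%:R :> rat.
Proof.
rewrite -mcoeff_sumX_exp mulfK; last by apply/prodf_neq0 => i _; apply: fact_neq0.
rewrite -[in RHS](card_ord L) -prodr_const bigA_distr_bigA raddf_sum /=.
apply: eq_bigr => c _.
by rewrite mprodXE mcoeffX.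
Qed.

Lemma edge_max_lt n (e f : {set 'I_(2 * n)}) : e != set0 -> f != set0 ->
  (edge_max e < edge_min f)%N = set_lt e f.
Proof.
move=> /set0Pn[x xe] /set0Pn[y yf]; apply/idP/set_ltP => [lt a b ae bf|h].
  apply: leq_trans (edge_min_le bf); apply: leq_ltn_trans lt.
  exact: (@leq_bigmax_cond _ _ (fun a => val a) _ ae).
have [a ae ->] : exists2 a, a \in e & edge_max e = a.
  have [a ae aE] := @eq_bigmax_cond _ (mem e) (fun a => val a) (introT (card_gt0P) (ex_intro _ x xe)).
  by exists a.
(* The default value [2 * n] of the minimum exceeds every vertex, so it satisfies the bound as
   well. *)
rewrite /edge_min; elim/big_ind: _ => [||b bf]; first exact: ltn_ord.
  by move=> p q ap aq; rewrite ltn_min ap.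
exact: h.
Qed.

Section MatchingColorings.
Variables (n N : nat) (M : perfect_matching n).
Let P := matching_poset M.
Let Mperf : is_perfect_matching (val M) := valP M.

Lemma edge_neq0 (e : P) : val e != set0.
Proof.
have /andP[_ /forall_inP/(_ _ (valP e)) /eqP e2] := Mperf.
by rewrite -card_gt0 e2.
Qed.

Definition as_edge e (eM : e \in val M) : P := exist (fun e => e \in val M) e eM.

Definition edge_of (v : 'I_(2 * n)) : P := as_edge (proj1 (pblock_matching Mperf v)).

Definition vertex_of (e : P) : 'I_(2 * n) := xchoose (set0Pn _ (edge_neq0 e)).

Lemma vertex_ofP e : vertex_of e \in val e.
Proof. exact: xchooseP. Qed.

Lemma edge_ofE (e : P) v : (edge_of v == e) = (v \in val e).
Proof.
rewrite -val_eqE /=; have [h1 h2] := pblock_matching Mperf v.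
apply/eqP/idP => [<- //|ve]; exact: (matching_eq Mperf h1 (valP e) h2 ve).
Qed.

(** The choice of [vertex_of e] affects only colourings that are not constant on edges; the second
    conjunct in [chain_coloringE], a side condition of [reindex_onto], excludes these. *)
Definition edge_coloring (c : {ffun 'I_(2 * n) -> 'I_N}) : {ffun P -> 'I_N} :=
  [ffun e => c (vertex_of e)].

Definition vertex_coloring (k : {ffun P -> 'I_N}) : {ffun 'I_(2 * n) -> 'I_N} :=
  [ffun v => k (edge_of v)].

Lemma vertex_coloringK : cancel vertex_coloring edge_coloring.
Proof.
move=> k; apply/ffunP => e; rewrite !ffunE; congr (k _); apply/eqP.
by rewrite edge_ofE vertex_ofP.
Qed.

Lemma Inc_edges (e f : P) :
  Inc P e f = [&& e != f, ~~ set_lt (val e) (val f) & ~~ set_lt (val f) (val e)].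
Proof. by rewrite IncE !edge_ltE !edge_max_lt ?edge_neq0. Qed.

Lemma chain_coloringE (c : {ffun 'I_(2 * n) -> 'I_N}) :
  proper_coloring (Inc P) (edge_coloring c)
    && (vertex_coloring (edge_coloring c) == c) = chain_coloring c (val M).
Proof.
apply/andP/chain_coloringP => [[pr /eqP ck]|[h1 h2]].
  have cE v : c v = edge_coloring c (edge_of v) by rewrite -{1}ck ffunE.
  split=> [e eM x y xe ye|e f eM fM x y xe yf cxy ef].
    rewrite !cE; congr (edge_coloring c _).
    have /eqP -> : edge_of x == as_edge eM by rewrite edge_ofE.
    by apply/esym/eqP; rewrite edge_ofE.
  have /eqP xE : edge_of x == as_edge eM by rewrite edge_ofE.
  have /eqP yE : edge_of y == as_edge fM by rewrite edge_ofE.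
  have /forallP/(_ (edge_of x))/forallP/(_ (edge_of y)) := pr.
  rewrite -!cE cxy eqxx implybF Inc_edges xE yE -val_eqE /= ef /= negb_and !negbK.
  by case/orP; [left|right].
split.
  apply/forallP => e; apply/forallP => f; apply/implyP; rewrite Inc_edges !ffunE.
  case/and3P=> ef lt1 lt2; apply/eqP => cef.
  have := h2 _ _ (valP e) (valP f) _ _ (vertex_ofP e) (vertex_ofP f) cef ef.
  by case; apply/negP.
apply/eqP/ffunP => v; rewrite !ffunE; apply: h1 (valP (edge_of v)) _ _ _ _.
  exact: vertex_ofP.
by rewrite -edge_ofE.
Qed.

Lemma coloring_mnm_edges (k : {ffun P -> 'I_N}) :
  coloring_mnm (vertex_coloring k) = ((\sum_e U_(k e)) *+ 2)%MM.
Proof.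
apply/mnmP => i; rewrite mulmnE !mnm_sumE.
rewrite (partition_big edge_of xpredT) //= big_distrl /=; apply: eq_bigr => e _.
rewrite (eq_bigr (fun=> U_(k e)%MM i)) => [|v /eqP ve]; last by rewrite ffunE ve.
rewrite (eq_bigl (mem (val e))) => [|v]; last by rewrite edge_ofE.
rewrite sum_nat_const mulnC.
by have /andP[_ /forall_inP/(_ _ (valP e)) /eqP ->] := Mperf.
Qed.

Lemma mcoeff_chromatic (m : 'X_{1..N}) :
  (chromatic (Inc P) N)@_m =
    \sum_(c : {ffun 'I_(2 * n) -> 'I_N} | chain_coloring c (val M))
      (coloring_mnm c == (m *+ 2)%MM)%:R.
Proof.
rewrite /chromatic raddf_sum /=.
rewrite (reindex_onto edge_coloring vertex_coloring) => [|k _]; last exact: vertex_coloringK.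
apply: eq_big => [c|c /andP[_ /eqP cE]]; first exact: chain_coloringE.
rewrite mprodXE mcoeffX -[in RHS]cE coloring_mnm_edges; congr (nat_of_bool _)%:R.
apply/eqP/eqP => [->//|/mnmP h]; apply/mnmP => i.
by have /eqP := h i; rewrite !mulmnE eqn_pmul2r // => /eqP.
Qed.

End MatchingColorings.

Definition matching_sum n : symfun := \sum_(M : perfect_matching n) sf_X (Inc (matching_poset M)).

(** After the sums are exchanged, a vertex colouring with class sizes [2 m_i] is compatible with
    exactly one matching. For [m] of degree [n] there are [(2n)! / prod_i (2 m_i)!] such
    colourings. *)
Lemma mcoeff_matching_sum n N (m : 'X_{1..N}) :
  (matching_sum n N)@_m
    = (mdeg m == n)%:R * (2 * n)`!%:R * \prod_i cosh_coef (m i).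
Proof.
rewrite -[matching_sum n N]/(sf_proj N _) /matching_sum raddf_sum raddf_sum /=.
rewrite (eq_bigr _ (fun M _ => mcoeff_chromatic M m)).
rewrite (exchange_big_dep xpredT) //=.
rewrite (eq_bigr (fun c : {ffun 'I_(2 * n) -> 'I_N} =>
   (coloring_mnm c == (m *+ 2)%MM)%:R)) => [|c _]; last first.
  rewrite sumr_const; case: eqP => [cm|_]; last by rewrite mul0rn.
  have ev i : ~~ odd #|fiber c i| by rewrite -coloring_mnmE cm mulmnE; lia.
  have pm := color_matching_perfect ev.
  rewrite (@eq_card1 _ (exist (fun M => is_perfect_matching M) _ pm)) // => M.
  rewrite !inE; apply/idP/eqP => [h|->]; last exact: color_matching_chain.
  by apply: val_inj; apply: color_matching_unique => //; apply: valP.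
rewrite count_colorings mdegMn mulnC eqn_pmul2l // -prodfV; congr (_ * _).
by apply: eq_bigr => i _; rewrite mulmnE mulnC.
Qed.

(** Divided by [(2n)!], both sides satisfy the same recursion: applying [omega] to the one for [G]
    multiplies [p_(k+1)] by [(-1)^k], which is the sign in [Asym_rec]. *)
Lemma Asym_matching_sum n : (2 * n)`!%:R *: Asym n = omega (matching_sum n).
Proof.
pose G k : symfun := (2 * k)`!%:R^-1 *: matching_sum k.
have Gu N k m : (G k N)@_m = (mdeg m == k)%:R * \prod_i cosh_coef (m i).
  rewrite -[G k N]/(_ *: matching_sum k N) mcoeffZ mcoeff_matching_sum.
  by rewrite mulrA [_ * (_ * _)]mulrCA mulVf ?fact_neq0 // mulr1.
suff AG : Asym n = omega (G n).
  by rewrite AG /G linearZ /= scalerA divff ?fact_neq0 // scale1r.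
elim/ltn_ind: n => -[_|n IHn].
  rewrite Asym0 (_ : G 0%N = 1) ?rmorph1 //; apply: symfunP => N.
  apply/mpolyP => m; rewrite Gu mcoeff1 -mdeg_eq0.
  have [m0|_] := eqVneq (mdeg m) 0%N; last by rewrite mul0r.
  rewrite big1 ?mulr1 // => i _.
  by move/eqP: m0; rewrite mdeg_eq0 => /eqP ->; rewrite mnm0E /cosh_coef invr1.
apply: (@scalerI _ _ (n.+1%:R : rat)); first by rewrite pnatr_eq0.
rewrite -[RHS]linearZ /= [X in omega X](sf_newton tanh_coef0 tanh_cosh Gu).
rewrite Asym_rec raddf_sum /=.
apply: eq_bigr => k _; rewrite linearZ rmorphM /= omega_p IHn; last first.
  by rewrite ltnS leq_subr.
by rewrite -scalerAl scalerA mulrC.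
Qed.

Theorem theorem7p1 (n : nat) (hn : (0 < n)%N) :
  (2 * n)`!%:R *: Asym n
    = \sum_(M : perfect_matching n) omega (sf_X (Inc (matching_poset M))).
Proof. by rewrite Asym_matching_sum /matching_sum raddf_sum. Qed.
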